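(* Let $D$ be a two-dimensional regular local ring with fixed regular system of parameters $x,y$, let $0<a<b$ be real numbers, and let $I=[a,b]$. Then the interval ring $T_I$ has Krull dimension one.
   Context: $D$ is a two-dimensional regular local ring with maximal ideal $\mathfrak m=(x,y)$ and quotient field $K$. Every nonzero element of $D$ can be written as $u_1\tau_1+\cdots+u_n\tau_n$ with $u_i$ units of $D$ and $\tau_i$ distinct monomials $x^py^q$ ($p,q\ge 0$ integers), none of which divides another in $D$; the set of monomials $\tau_i$ is uniquely determined by the element (and $x,y$). For real $r>0$, the monomial valuation $v_r$ on $K$ is defined by $v_r(0)=\infty$, $v_r(x^py^q)=p+qr$, $v_r(u_1\tau_1+\cdots+u_n\tau_n)=\min_i v_r(\tau_i)$ for such a representation, and $v_r(f/g)=v_r(f)-v_r(g)$ for $f,g\in D$, $g\neq 0$. Its valuation ring is $V_r=\{f\in K: v_r(f)\ge 0\}$. For $I=[a,b]$ the interval ring $T_I$ is the intersection of all valuation rings $V$ such that $D\subseteq V\subseteq V_r$ for some $r\in I$. *)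

(* Defs.v *)
From HB Require Import structures.
From mathcomp Require Import all_boot all_order all_algebra.
From mathcomp Require Import ring_quotient.
From mathcomp Require Import boolp classical_sets reals constructive_ereal.

Set Implicit Arguments.
Unset Strict Implicit.
Unset Printing Implicit Defensive.

Import Order.TTheory GRing.Theory Num.Theory.
Local Open Scope ring_scope.

Section CommutativeAlgebra.
Variable A : comNzRingType.
Implicit Types (S P : {pred A}) (s : seq A) (n : nat).
Implicit Types (C : nat -> {pred A}).

(* Unlike [idealr_closed], this admits the unit ideal. *)
Definition ideal_closed S : Prop :=
  0 \in S /\ forall a, {in S &, forall u v, a * u + v \in S}.

Definition ideal_gen s : {pred A} :=
  [pred z | `[< exists c : 'I_(size s) -> A,
                  z = \sum_(i < size s) c i * s`_i >]].

Definition noetherian : Prop :=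
  forall S, ideal_closed S -> exists s, S =i ideal_gen s.

(* [idealr_closed] contains 1 \notin P. *)
Definition prime_ideal P : Prop := idealr_closed P /\ prime_idealr_closed P.

Definition maximal_ideal P : Prop :=
  idealr_closed P /\
  forall S, idealr_closed S -> {subset P <= S} -> S =i P.

Definition local_with_maximal_ideal P : Prop :=
  maximal_ideal P /\ forall S, maximal_ideal S -> S =i P.

(* C 0 < C 1 < ... < C n; the values of C beyond n are irrelevant. *)
Definition prime_chain n C : Prop :=
  (forall i, (i <= n)%N -> prime_ideal (C i)) /\
  (forall i, (i < n)%N -> {subset C i <= C i.+1} /\
                          exists2 z, z \in C i.+1 & z \notin C i).

Definition krull_dim_is n : Prop :=
  (exists C, prime_chain n C) /\
  (forall m C, prime_chain m C -> (m <= n)%N).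

(* A regular local ring of dimension d, with regular system of parameters t. *)
Definition regular_local_ring d (t : d.-tuple A) : Prop :=
  [/\ noetherian, local_with_maximal_ideal (ideal_gen t) & krull_dim_is d].

End CommutativeAlgebra.

Definition valuation_subring (K : fieldType) (V : {pred K}) : Prop :=
  subring_closed V /\ forall z : K, z != 0 -> z \in V \/ z^-1 \in V.

Section MonomialValuations.
Variables (R : realType) (D : idomainType) (x y : D).
Notation K := {fraction D}.
Implicit Types (r : R) (I : set R) (f : D) (z : K).

Definition monomial (e : nat * nat) : D := x ^+ e.1 * y ^+ e.2.

(* f = u_0 t_0 + ... + u_(n-1) t_(n-1), with u_i units and t_i distinct
   monomials, none of which divides another; e i is the exponent of t_i. *)
Definition monomial_rep f n (u : 'I_n -> D) (e : 'I_n -> nat * nat) : Prop :=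
  [/\ forall i, u i \is a GRing.unit,
      injective (fun i => monomial (e i)),
      forall i j, i != j ->
        ~ exists c : D, monomial (e j) = c * monomial (e i) &
      f = \sum_(i < n) u i * monomial (e i)].

Definition monomial_weight r (e : nat * nat) : R := e.1%:R + e.2%:R * r.

Definition monomial_rep_value r f (w : \bar R) : Prop :=
  exists n (u : 'I_n -> D) (e : 'I_n -> nat * nat),
    monomial_rep f u e /\
    w = \big[Order.min/+oo%E]_(i < n) (monomial_weight r (e i))%:E.

(* The value is computed from a chosen representation of f; when x, y is a
   regular system of parameters of a two-dimensional regular local ring, one
   exists for every f != 0, and its set of monomials does not depend on the
   choice. *)
Definition monomial_valuation_dom r f : \bar R :=
  if f == 0 then +oo%E else xget +oo%E [set w | monomial_rep_value r f w].

(* Computed from a chosen fraction representing z; its denominator is nonzero. *)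
Definition monomial_valuation r z : \bar R :=
  (monomial_valuation_dom r (\n_(repr z))
   - monomial_valuation_dom r (\d_(repr z)))%E.

Definition monomial_valuation_ring r : {pred K} :=
  [pred z | (0 <= monomial_valuation r z)%E].

Definition interval_pred I : {pred K} :=
  [pred z | `[< forall V : {pred K}, valuation_subring V ->
                  (forall f, tofrac f \in V) ->
                  (exists2 r, I r & {subset V <= monomial_valuation_ring r}) ->
                  z \in V >]].

Fact interval_subring_closed I : subring_closed (interval_pred I).
Proof.
split=> [|z t|z t].
- by apply/asboolP => V [[V1 _ _] _] _ _.
- move=> /asboolP zT /asboolP tT; apply/asboolP => V VV DV IV.
  by have [[_ VB _] _] := VV; apply: VB; [apply: zT | apply: tT].
- move=> /asboolP zT /asboolP tT; apply/asboolP => V VV DV IV.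
  by have [[_ _ VM] _] := VV; apply: VM; [apply: zT | apply: tT].
Qed.

HB.instance Definition _ I :=
  GRing.isSubringClosed.Build K (interval_pred I) (interval_subring_closed I).

(* T_I, as a ring in its own right. *)
Record interval_ring I := IntervalRing {
  interval_ring_val :> K;
  _ : interval_ring_val \in interval_pred I }.

HB.instance Definition _ I := [isSub for @interval_ring_val I].
HB.instance Definition _ I := [Choice of interval_ring I by <:].
HB.instance Definition _ I :=
  [SubChoice_isSubComNzRing of interval_ring I by <:].

End MonomialValuations.

(* Main.v *)
Require Import Defs.
From mathcomp Require Import all_boot all_order all_algebra.
From mathcomp Require Import ring_quotient ring lra.
From mathcomp Require Import boolp classical_sets reals set_interval constructive_ereal.

Set Implicit Arguments.
Unset Strict Implicit.
Unset Printing Implicit Defensive.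

Import Order.TTheory GRing.Theory Num.Theory.
Local Open Scope ring_scope.
Local Open Scope classical_set_scope.

(** For r in [a, b], let v_r be the monomial valuation, V_r its valuation ring
    and M_r the maximal ideal of V_r.  The interval ring T is local, its maximal
    ideal consists of the f with v_r(f) > 0 for all r in [a, b], and of two
    nonzero elements of that ideal each divides a power of the other; hence T
    has exactly one nonzero prime ideal.

    The decisive point is that an element f of T with v_r(f) = 0 for one r in
    [a, b] is a unit.  By Chevalley's extension theorem, an f that lies in all
    valuation rings between D and V_r is congruent modulo M_r to a polynomial in
    f^-1 with coefficients in D ([congruent_inv_polynomial]), so it satisfies a
    monic equation modulo M_r; as nonunits of D lie in M_r, this leaves a
    relation 1 - f q(f) in M_r with q in D[X] ([unit_relation]).  The relation
    puts f^-1 into every valuation ring between D and V_r.  Since the value of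
    1 - f q(f) depends continuously on r, it also forces v_s(f) = 0 for all s
    near r.  So r |-> v_r(f) is either 0 on [a, b] or bounded below by a positive
    constant ([val_dichotomy]).  In the first case f^-1 is in T, in the second
    f^n / g has positive values on [a, b] for every g <> 0 and large n, which
    puts it into T ([power_div_in_all_dominated]).

    That v_r is a valuation rests on the independence of monomials: x^p y^q is not
    in (x^(p+1), y^(q+1)) ([monomial_notin_pyramid]).  This follows from y being
    regular modulo x, which in turn needs that no power of y lies in (x); that is
    where dimension two enters, through a special case of Krull's principal ideal
    theorem ([power_y_notin_x]).  Ordering monomials by weight and then by
    x-exponent, every nonzero element has a well-defined leading monomial, and
    leading monomials multiply ([leading_unique], [leading_mul]). *)

(** * Ideals of a noetherian ring *)

Section Ideals.
Variable A : comNzRingType.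
Implicit Types (J P : set A) (a b c d e t : A).

Definition ideal J := J 0 /\ forall a u v, J u -> J v -> J (a * u + v).

Section Closure.
Variables (J : set A) (idJ : ideal J).

Lemma ideal0 : J 0. Proof. by case: idJ. Qed.

Lemma idealMl a u : J u -> J (a * u).
Proof. by case: idJ => J0 JD Ju; rewrite -[a * u]addr0; apply: JD. Qed.

Lemma idealMr a u : J u -> J (u * a).
Proof. by rewrite mulrC; apply: idealMl. Qed.

Lemma idealD u v : J u -> J v -> J (u + v).
Proof. by case: idJ => _ JD Ju Jv; rewrite -[u]mul1r; apply: JD. Qed.

Lemma idealN u : J u -> J (- u).
Proof. by rewrite -mulN1r; apply: idealMl. Qed.

Lemma idealB u v : J u -> J v -> J (u - v).
Proof. by move=> Ju /idealN; apply: idealD. Qed.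

Lemma ideal_sum I (s : seq I) (Q : pred I) (F : I -> A) :
  (forall i, Q i -> J (F i)) -> J (\sum_(i <- s | Q i) F i).
Proof. by move=> JF; elim/big_ind: _ => //; [exact: ideal0|exact: idealD]. Qed.

End Closure.

Definition add_principal J t : set A := [set d | exists j e, J j /\ d = j + t * e].

Lemma ideal_add_principal J t : ideal J -> ideal (add_principal J t).
Proof.
move=> idJ; split; first by exists 0, 0; split; [exact: ideal0 | ring].
move=> a _ _ [j [e [Jj ->]]] [j' [e' [Jj' ->]]].
exists (a * j + j'), (a * e + e'); split; last by ring.
by apply: idealD => //; apply: idealMl.
Qed.

Definition principal t : set A := [set d | exists e, d = t * e].

Lemma ideal_principal t : ideal (principal t).
Proof.
split=> [|a _ _ [e ->] [e' ->]]; first by exists 0; rewrite mulr0.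
by exists (a * e + e'); ring.
Qed.

Lemma ideal_closed_mem J : ideal J -> ideal_closed (mem J : {pred A}).
Proof.
move=> [J0 JD]; split=> [|a u v]; first exact: mem_set.
by move=> /set_mem Ju /set_mem Jv; apply/mem_set/JD.
Qed.

Lemma ideal_chain_bigcup (J : nat -> set A) :
    (forall n, ideal (J n)) -> (forall n, J n `<=` J n.+1) ->
  ideal (\bigcup_n J n).
Proof.
move=> idJ leJ; have mono m n : (m <= n)%N -> J m `<=` J n.
  by move/subnK <-; elim: (n - m)%N => //= k IH u /IH /leJ.
split=> [|a u v [m _ Ju] [n _ Jv]]; first by exists 0%N => //; apply: ideal0.
exists (maxn m n) => //; apply: idealD => //.
  by apply: idealMl => //; apply: mono Ju; rewrite leq_maxl.
by apply: mono Jv; rewrite leq_maxr.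
Qed.

Lemma noetherian_acc (J : nat -> set A) : noetherian A ->
    (forall n, ideal (J n)) -> (forall n, J n `<=` J n.+1) ->
  exists K, forall n, J n `<=` J K.
Proof.
move=> noethA idJ leJ; have idU := ideal_chain_bigcup idJ leJ.
have mono m n : (m <= n)%N -> J m `<=` J n.
  by move/subnK <-; elim: (n - m)%N => //= k IH u /IH /leJ.
have [s /= sU] := noethA _ (ideal_closed_mem idU).
have sUP z : (\bigcup_n J n) z <-> z \in ideal_gen s.
  by rewrite -sU; split=> [?|/set_mem //]; apply/mem_set.
have sJ (i : 'I_(size s)) : exists n, J n s`_i.
  suff /sUP [n _ Jn] : s`_i \in ideal_gen s by exists n.
  apply/asboolP; exists (fun j => (j == i)%:R).
  rewrite (bigD1 i) //= eqxx mul1r big1 ?addr0 // => j /negPf ->.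
  by rewrite mul0r.
have [N JN] := choice sJ; exists (\max_i N i) => n z Jz.
have /sUP/asboolP [c ->] : (\bigcup_n J n) z by exists n.
apply: ideal_sum => // i _; apply: idealMl => //.
by apply: mono (JN i); apply: leq_bigmax.
Qed.


(** Krull's intersection theorem for a principal ideal.  If d = j_k + t^k t_k
    with j_k in J for all k, the ideals {e | t^k (e - c t_k) in J for some c}
    increase with k, because t^k (t_k - t t_(k+1)) lies in J.  Where they become
    stationary, t_(k+1) is a multiple c t_k modulo t^k-torsion, so that
    (1 - c t) t_(k+1) is torsion as well. *)
Lemma principal_krull_intersection J t d : noetherian A -> ideal J ->
    (forall c, exists u, u * (1 - c * t) = 1) ->
    (forall k, add_principal J (t ^+ k) d) -> J d.
Proof.
move=> noethA idJ unit1 dP.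
have /choice [q qP] : forall k, exists e, J (d - t ^+ k * e).
  by move=> k; have [j [e [Jj ->]]] := dP k; exists e; rewrite addrK.
have qS k : J (t ^+ k * (q k - t * q k.+1)).
  have -> : t ^+ k * (q k - t * q k.+1) =
            (d - t ^+ k.+1 * q k.+1) - (d - t ^+ k * q k) by rewrite exprS; ring.
  exact: idealB.
pose B k : set A := [set e | exists c, J (t ^+ k * (e - c * q k))].
have idB k : ideal (B k).
  split=> [|a u v [c Ju] [c' Jv]].
    by exists 0; rewrite mul0r subr0 mulr0; apply: ideal0.
  exists (a * c + c').
  have -> : t ^+ k * (a * u + v - (a * c + c') * q k) =
    a * (t ^+ k * (u - c * q k)) + t ^+ k * (v - c' * q k) by ring.
  by case: idJ => _; apply.
have leB k : B k `<=` B k.+1.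
  move=> e [c Je]; exists (c * t).
  have -> : t ^+ k.+1 * (e - c * t * q k.+1) =
    t * (t ^+ k * (e - c * q k) + c * (t ^+ k * (q k - t * q k.+1))).
    by rewrite exprS; ring.
  by apply: idealMl => //; apply: idealD => //; apply: idealMl.
have [K BK] := noetherian_acc noethA idB leB.
have [c Jc] : B K (q K.+1).
  by apply: (BK K.+1); exists 1; rewrite mul1r subrr mulr0; apply: ideal0.
have [u uP] := unit1 c.
have Jq : J (t ^+ K * q K.+1).
  have -> : t ^+ K * q K.+1 = u * (t ^+ K * (q K.+1 - c * q K) +
      c * (t ^+ K * (q K - t * q K.+1))).
    by rewrite -[LHS]mul1r -uP; ring.
  by apply: idealMl => //; apply: idealD => //; apply: idealMl.
have -> : d = (d - t ^+ K.+1 * q K.+1) + t * (t ^+ K * q K.+1).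
  by rewrite exprS; ring.
by apply: idealD => //; apply: idealMl.
Qed.

(** The exponent l is the largest one with c in J + (t^l). *)
Lemma add_principal_factor J t c : noetherian A -> ideal J ->
    (forall c, exists u, u * (1 - c * t) = 1) -> ~ J c ->
  exists l j e, [/\ J j, c = j + t ^+ l * e & ~ add_principal J t e].
Proof.
move=> noethA idJ unit1 nJc.
have [k nk] : exists k, ~ add_principal J (t ^+ k) c.
  by apply/existsNP => ?; apply/nJc/(principal_krull_intersection noethA _ unit1).
have [l [j [e [Jj cE]]] nl] : exists2 l, add_principal J (t ^+ l) c &
    ~ add_principal J (t ^+ l.+1) c.
  elim: k nk => [|k IH] nk.
    by case: nk; exists 0, c; rewrite expr0 mul1r add0r; split=> //; apply: ideal0.
  by have [kP|/IH //] := EM (add_principal J (t ^+ k) c); exists k.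
exists l, j, e; split=> // -[j' [e' [Jj' eE]]]; apply: nl.
exists (j + t ^+ l * j'), e'; rewrite cE eE exprSr; split; last by ring.
by apply: idealD => //; apply: idealMl.
Qed.

End Ideals.

(** * Maximal sets *)

Section Zorn.
Variable T : Type.

Lemma zorn_extension (Q : set (set T)) (B : set T) : Q B ->
    (forall F : set (set T), F `<=` Q -> F !=set0 -> total_on F subset ->
      Q (\bigcup_(X in F) X)) ->
  exists M, [/\ B `<=` M, Q M & forall N, M `<=` N -> Q N -> N `<=` M].
Proof.
move=> QB Qchain.
have [F FQ totF|A [QA Amax]] := @Zorn_bigcup T [set S | Q (B `|` S)].
  rewrite /mkset; have [->|/set0P F0] := eqVneq F set0.
    by rewrite bigcup_set0 setU0.
  have -> : B `|` \bigcup_(X in F) X =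
            \bigcup_(X in [set B `|` S | S in F]) X.
    rewrite bigcup_image; apply/seteqP; split=> [u|u [S FS [Bu|Su]]].
    - have [S FS] := F0.
      by move=> [Bu|[X FX Xu]]; [exists S|exists X] => //; [left|right].
    - by left.
    - by right; exists S.
  apply: Qchain => [_ [S FS <-]||_ _ [S FS <-] [S' FS' <-]]; first exact: FQ.
    by have [S FS] := F0; exists (B `|` S); exists S.
  by have [?|?] := totF _ _ FS FS'; [left|right]; apply: setUS.
exists (B `|` A); split=> // N BAN QN.
apply: contrapT => nNA; apply: (Amax N); last first.
  by rewrite /mkset setUidr // => u Bu; apply: BAN; left.
split=> [u Au|NA]; first by apply: BAN; right.
by apply: nNA => u /NA; right.
Qed.

Lemma chain_bigcup2 (F : set (set T)) u v : total_on F subset ->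
    (\bigcup_(X in F) X) u -> (\bigcup_(X in F) X) v ->
  exists X, [/\ F X, X u & X v].
Proof.
move=> totF [X FX Xu] [Y FY Yv].
by have [XY|YX] := totF _ _ FX FY; [exists Y|exists X]; split=> //;
  [apply: XY|apply: YX].
Qed.

End Zorn.

(** * Two-dimensional regular local rings *)

Section RegularLocalRing.
Variables (D : idomainType) (x y : D).
Hypothesis reg : regular_local_ring [tuple x; y].
Implicit Types (J P : set D) (c d f u : D).

Local Notation ideal_xy := (add_principal (principal x) y).

Let noethD : noetherian D. Proof. by case: reg. Qed.

Lemma ideal_gen_xy z : z \in ideal_gen [tuple x; y] <-> ideal_xy z.
Proof.
split=> [/asboolP [c ->]|[_ [e [[e' ->] ->]]]].
  rewrite !big_ord_recl big_ord0 /=; exists (x * c ord0), (c (lift ord0 ord0)).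
  by split; [exists (c ord0) | ring].
apply/asboolP; exists (fun i => if i == ord0 then e' else e).
by rewrite !big_ord_recl big_ord0 /=; ring.
Qed.

Lemma idealr_closed_mem J : ideal J -> ~ J 1 -> idealr_closed (mem J : {pred D}).
Proof.
move=> /ideal_closed_mem [J0 JD] J1; split=> //.
by apply/negP => /set_mem.
Qed.

Lemma ideal_xyW : ideal ideal_xy.
Proof. exact/ideal_add_principal/ideal_principal. Qed.

Lemma not_ideal_xy1 : ~ ideal_xy 1.
Proof.
by case: reg => _ [[[_ m1 _] _] _] _ /ideal_gen_xy; apply/negP.
Qed.

Lemma nonunit_ideal_xy c : c \isn't a GRing.unit -> ideal_xy c.
Proof.
move=> cNu.
pose Q : set (set D) := [set J | ideal J /\ ~ J 1].
have Qc : Q (principal c).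
  split; first exact: ideal_principal.
  move=> [e ce1]; case/negP: cNu; apply/unitrPr; by exists e.
have [F FQ [X0 FX0] totF|M [cM [idM M1] maxM]] := zorn_extension Qc.
  split; last by move=> [X FX X1]; case: (FQ _ FX).
  split=> [|a u v Fu Fv]; first by exists X0 => //; apply: ideal0; case: (FQ _ FX0).
  have [X [FX Xu Xv]] := chain_bigcup2 totF Fu Fv.
  by exists X => //; have [[_ XD] _] := FQ _ FX; apply: XD.
have [_ [_ maxE] _] := reg.
have /maxE ME : maximal_ideal (mem M : {pred D}).
  split=> [|S [S0 S1 SD] MS z]; first exact: idealr_closed_mem.
  apply/idP/idP => [zS|]; last exact: MS.
  apply/mem_set; apply: (maxM [set z | z \in S]) => //.
    by move=> w Mw; apply/MS/mem_set.
  by split; [split=> // a u v; apply: SD | apply/negP].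
apply/ideal_gen_xy; rewrite -ME; apply/mem_set/cM; exists 1; by rewrite mulr1.
Qed.

Lemma ideal_xy_nonunit c : ideal_xy c -> c \isn't a GRing.unit.
Proof.
move=> mc; apply/negP => cU; apply: not_ideal_xy1.
by rewrite -(mulVr cU); apply: idealMl => //; apply: ideal_xyW.
Qed.

Lemma ideal_xy_x : ideal_xy x.
Proof. by exists x, 0; split; [exists 1; rewrite mulr1 | ring]. Qed.

Lemma ideal_xy_y : ideal_xy y.
Proof. by exists 0, 1; split; [exists 0; rewrite mulr0 | ring]. Qed.

Lemma unitB_ideal_xy u c : u \is a GRing.unit -> ideal_xy c ->
  u - c \is a GRing.unit.
Proof.
move=> uU mc; apply/negPn/negP => /nonunit_ideal_xy mB.
have := ideal_xy_nonunit (idealD ideal_xyW mB mc).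
by rewrite subrK uU.
Qed.

Lemma inv_1B_ideal_xy t : ideal_xy t -> forall c, exists u, u * (1 - c * t) = 1.
Proof.
move=> mt c; exists (1 - c * t)^-1; apply: mulVr.
by apply: unitB_ideal_xy (unitr1 _) _; apply: idealMl => //; apply: ideal_xyW.
Qed.

Lemma mod_x_normal_form d : ~ principal x d ->
  exists u j t, u \is a GRing.unit /\ d = u * y ^+ j + x * t.
Proof.
move=> /(add_principal_factor noethD (ideal_principal x)
  (inv_1B_ideal_xy ideal_xy_y)) [j [_ [u [[t ->] -> nu]]]].
exists u, j, t; split; last by ring.
by apply/negPn/negP => /nonunit_ideal_xy.
Qed.

Definition prime_set P :=
  [/\ ideal P, ~ P 1 & forall u v, P (u * v) -> P u \/ P v].

(** The middle prime of a chain of length two. *)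
Lemma exists_intermediate_prime :
  exists P g, [/\ prime_set P, P g, g != 0 & ~ (P x /\ P y)].
Proof.
have [_ _ [[C [Cprime Clt]] _]] := reg.
have [C01 [g gC1 gC0]] := Clt 0%N isT.
have [C12 [w wC2 wC1]] := Clt 1%N isT.
have [[[C1_0 C1_1 C1D] C1prime] [[C2_0 C2_1 C2D] _]] :=
  (Cprime 1%N isT, Cprime 2%N isT).
have [[C0_0 _ _] _] := Cprime 0%N isT.
exists [set z | z \in C 1%N], g; split=> //.
- split=> [|/=|u v /C1prime /orP //]; last exact/negP.
  by split=> // a u v; apply: C1D.
- by apply: contraNneq gC0 => ->.
move=> [xP yP]; case/negP: wC1.
suff [_ [e [[a ->] ->]]] : ideal_xy w.
  rewrite mulrC [y * e]mulrC; apply: (C1D) => //.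
  by rewrite -[e * y]addr0; apply: C1D.
apply: nonunit_ideal_xy; apply: contra C2_1 => wU.
by rewrite -(mulVr wU) -[_ * w]addr0; apply: C2D.
Qed.

Lemma prime_setX P u k : prime_set P -> P (u ^+ k) -> P u.
Proof.
move=> [_ P1 Pprime]; elim: k => [/P1 //|k IH].
by rewrite exprS => /Pprime [|/IH].
Qed.

(** The special case of Krull's principal ideal theorem that is needed: if y^n
    lay in (x), a nonzero prime P other than (x, y) would not contain x.  For
    g in P the ideals Q n of the d with s d in (g^n), s outside P, decrease;
    modulo x they are generated by powers of y, so two consecutive ones have the
    same image.  Then Q n = Q (n+1) + x Q n because x is not in P, and Krull's
    intersection theorem gives g^n in Q (n+1), hence s g^n = g^(n+1) t with s
    outside P, which is absurd in a domain. *)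
Lemma power_y_notin_x n : ~ principal x (y ^+ n).
Proof.
move=> [c0 ync].
have [P [g [Pprime Pg g0 nPxy]]] := exists_intermediate_prime.
have [idP P1 PM] := Pprime.
have xP : ~ P x.
  move=> Px; apply: nPxy; split=> //; apply: (@prime_setX _ _ n) => //.
  by rewrite ync; apply: idealMr.
pose Q k : set D := [set d | exists s t, ~ P s /\ s * d = g ^+ k * t].
have PN s s' : ~ P s -> ~ P s' -> ~ P (s * s') by move=> sP s'P /PM [].
have idQ k : ideal (Q k).
  split=> [|a u v [s [t [sP st]]] [s' [t' [s'P st']]]].
    by exists 1, 0; split=> //; ring.
  exists (s * s'), (a * s' * t + s * t'); split; first exact: PN.
  have -> : s * s' * (a * u + v) = a * s' * (s * u) + s * (s' * v) by ring.
  by rewrite st st'; ring.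
have leQ k : Q k.+1 `<=` Q k.
  move=> d [s [t [sP st]]]; exists s, (g * t); split=> //.
  by rewrite st exprS; ring.
pose R k i := `[< add_principal (Q k) x (y ^+ i) >].
have Rn k : exists i, R k i.
  exists n; apply/asboolP; exists 0, c0.
  by split; [exact: ideal0 | rewrite add0r].
pose i k := ex_minn (Rn k).
have iP k : add_principal (Q k) x (y ^+ i k).
  by rewrite /i; case: ex_minnP => j /asboolP.
have imin k j : add_principal (Q k) x (y ^+ j) -> (i k <= j)%N.
  by rewrite /i => kj; case: ex_minnP => j' _; apply; apply/asboolP.
have [k ik] : exists k, i k = i k.+1.
  apply/not_existsP => iN.
  have ltiS k : (i k < i k.+1)%N.
    rewrite ltn_neqAle; apply/andP; split; first exact/eqP/iN.
    by apply: imin; have [j [e [/leQ Qj ->]]] := iP k.+1; exists j, e.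
  have lei k : (k <= i k)%N by elim: k => // k IH; apply: leq_ltn_trans IH (ltiS k).
  have := lei n.+1; apply/negP; rewrite -ltnNge ltnS; apply: imin.
  by exists 0, c0; split; [exact: ideal0 | rewrite add0r].
have QS d : Q k d -> add_principal (Q k.+1) x d.
  move=> Qd; have idQS := ideal_add_principal x (idQ k.+1).
  have [[t ->]|/mod_x_normal_form [u [j [t [uU dE]]]]] := EM (principal x d).
    by exists 0, t; split; [exact: ideal0 | ring].
  have le_ij : (i k <= j)%N.
    apply: imin; exists (u^-1 * d), (- u^-1 * t); split; first exact: idealMl.
    by rewrite -[LHS]mul1r -(mulVr uU) dE; ring.
  rewrite dE; apply: idealD => //; last by exists 0, t; split; [exact: ideal0|ring].
  by rewrite -(subnK le_ij) exprD; do 2!apply: idealMl => //; rewrite ik.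
have QE : Q k `<=` Q k.+1.
  move=> d Qd; apply: (principal_krull_intersection noethD (idQ _)
      (inv_1B_ideal_xy ideal_xy_x)) => m.
  suff [j [e [Qj Qe ->]]] : exists j e,
    [/\ Q k.+1 j, Q k e & d = j + x ^+ m * e] by exists j, e.
  elim: m => [|m [j [e [Qj Qe dE]]]].
    by exists 0, d; split=> //; [exact: ideal0 | ring].
  have [j' [e' [Qj' eE]]] := QS e Qe.
  exists (j + x ^+ m * j'), e'; split; last by rewrite dE eE exprS; ring.
    by apply: idealD => //; apply: idealMl.
  have [s [t [sP st]]] : Q k (x * e').
    by rewrite (_ : x * e' = e - j'); [apply: idealB => //; apply: leQ | rewrite eE; ring].
  by exists (s * x), t; split; [exact: PN | rewrite -mulrA].
have [s [t [sP]]] : Q k.+1 (g ^+ k) by apply: QE; exists 1, 1; split=> //; ring.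
move=> gE; have /mulIf gk : g ^+ k != 0 by rewrite expf_neq0.
have sE : s = t * g by apply: gk; rewrite /= gE exprS; ring.
by apply: sP; rewrite sE; apply: idealMl.
Qed.

(** Outside (x), an element c is a unit times y^j modulo x; if y^q c were in (x),
    so would be y^(q+j). *)
Lemma y_regular_mod_x q c : principal x (y ^+ q * c) -> principal x c.
Proof.
move=> [e yce]; apply: contrapT => /mod_x_normal_form [u [j [t [uU cE]]]].
apply: (@power_y_notin_x (q + j)); exists (u^-1 * (e - y ^+ q * t)).
have -> : x * (u^-1 * (e - y ^+ q * t)) = u^-1 * (x * e - y ^+ q * (x * t)) by ring.
by rewrite -yce cE -mulrBr addrK -{1}[y ^+ _]mul1r -(mulVr uU) exprD; ring.
Qed.

Lemma x_nonunit : x \isn't a GRing.unit.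
Proof. exact: ideal_xy_nonunit ideal_xy_x. Qed.

Lemma x_neq0 : x != 0.
Proof.
apply/eqP => x0.
have [P [g [Pprime Pg g0 nPxy]]] := exists_intermediate_prime.
have [idP _ _] := Pprime; apply: nPxy; rewrite x0; split; first exact: ideal0.
have [|u [j [t [uU gE]]]] := @mod_x_normal_form g.
  by move=> [e]; rewrite x0 mul0r; apply/eqP.
apply: (@prime_setX _ _ j) => //; rewrite -[_ ^+ j]mul1r -(mulVr uU) -mulrA.
by apply: idealMl => //; move: Pg; rewrite gE x0 mul0r addr0.
Qed.

(** As y is regular modulo the powers of x, such an equation gives
    x^p - b y in (x^(p+1)), then b in (x^p), and finally 1 in (x, y).  This is the
    independence of monomials on which the monomial valuations rest. *)
Lemma monomial_notin_pyramid p q a b :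
  x ^+ p * y ^+ q <> a * x ^+ p.+1 + b * y ^+ q.+1.
Proof.
have ymodx k m c : (exists e, y ^+ m * c = x ^+ k * e) -> exists e, c = x ^+ k * e.
  elim: k c => [|k IH] c [e cE]; first by exists c; rewrite mul1r.
  have [|c' c'E] := @y_regular_mod_x m c.
    by exists (x ^+ k * e); rewrite cE exprS; ring.
  have [|e' e'E] := IH c'; last by exists e'; rewrite c'E e'E exprS; ring.
  by exists e; apply: (mulfI x_neq0); rewrite /= [RHS]mulrA -exprS -cE c'E; ring.
move=> E; have [|d dE] := ymodx p.+1 q (x ^+ p - b * y).
  exists a; have -> : y ^+ q * (x ^+ p - b * y) =
    x ^+ p * y ^+ q - b * y ^+ q.+1 by rewrite exprS; ring.
  by rewrite E; ring.
have [|b' bE] := ymodx p 1%N b.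
  exists (1 - x * d); have -> : y ^+ 1 * b = x ^+ p - (x ^+ p - b * y) by ring.
  by rewrite dE exprS; ring.
apply: not_ideal_xy1; suff -> : 1 = x * d + y * b'.
  by exists (x * d), b'; split=> //; exists d.
apply: (mulfI (expf_neq0 p x_neq0)); rewrite mulr1 mulrDr mulrA -exprSr -dE bE.
by ring.
Qed.

Lemma monomial_dvd e e' c :
  monomial x y e = c * monomial x y e' -> (e'.1 <= e.1)%N /\ (e'.2 <= e.2)%N.
Proof.
case: e e' => [p q] [p' q'] /=; rewrite /monomial /= => E.
split; rewrite leqNgt; apply/negP => lt.
  apply: (@monomial_notin_pyramid p q (c * x ^+ (p' - p.+1) * y ^+ q') 0).
  by rewrite E -{1}(subnK lt) exprD; ring.
apply: (@monomial_notin_pyramid p q 0 (c * x ^+ p' * y ^+ (q' - q.+1))).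
by rewrite E -{1}(subnK lt) exprD; ring.
Qed.

(** * Existence of monomial representations *)

(** The x-exponents increase and the y-exponents decrease along a staircase, so
    that none of its monomials divides another. *)
Definition staircase (s : seq (D * (nat * nat))) :=
  all (fun t => t.1 \is a GRing.unit) s &&
  pairwise (fun t t' => (t.2.1 < t'.2.1)%N && (t'.2.2 < t.2.2)%N) s.

Definition staircase_sum (s : seq (D * (nat * nat))) :=
  \sum_(t <- s) t.1 * monomial x y t.2.

Definition staircase_shift l (s : seq (D * (nat * nat))) :=
  [seq (t.1, ((t.2.1 + l)%N, t.2.2)) | t <- s].

Lemma staircase_sum_shift l s :
  staircase_sum (staircase_shift l s) = x ^+ l * staircase_sum s.
Proof.
rewrite /staircase_sum big_map mulr_sumr; apply: eq_bigr => t _.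
by rewrite /monomial /= exprD; ring.
Qed.

Lemma staircase_cons_shift u l j s :
    u \is a GRing.unit -> staircase s -> all (fun t => (t.2.2 < j)%N) s ->
  staircase ((u, (l, j)) :: staircase_shift l.+1 s).
Proof.
move=> uU /andP [sU sP] sj; apply/andP; split=> /=.
  by rewrite uU all_map.
rewrite all_map pairwise_map; apply/andP; split.
  by apply: sub_all sj => t /= ->; rewrite addnS ltnS leq_addl.
by apply: sub_pairwise sP => t t' /=; rewrite ltn_add2r.
Qed.

(** If x^l is the largest power of x dividing c modulo y^j, the cofactor is a unit
    times y^i with i < j, up to a multiple of x; that multiple is expanded modulo
    y^i, and the multiple of y^i that appears is absorbed by the unit. *)
Lemma staircase_mod_y j c : exists d s,
  [/\ staircase s, all (fun t => (t.2.2 < j)%N) s &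
      c = d * y ^+ j + staircase_sum s].
Proof.
elim/ltn_ind: j c => j IH c.
have [[d cE]|] := EM (principal (y ^+ j) c).
  by exists d, [::]; split=> //; rewrite /staircase_sum big_nil cE; ring.
move=> /(add_principal_factor noethD (ideal_principal _)
  (inv_1B_ideal_xy ideal_xy_x)) [l [_ [c' [[d ->] -> nc']]]].
have [|u [i [t [uU c'E]]]] := @mod_x_normal_form c'.
  move=> [e c'E]; apply: nc'; exists 0, e; rewrite c'E; split; last by ring.
  exact: (ideal0 (ideal_principal _)).
have lt_ij : (i < j)%N.
  rewrite ltnNge; apply/negP => le_ji; apply: nc'; rewrite c'E.
  exists (y ^+ j * (u * y ^+ (i - j))), t; split=> //; first by eexists.
  by rewrite -{1}(subnK le_ji) exprD; ring.
have [d' [s [sS si tE]]] := IH i lt_ij t.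
exists d, ((u + d' * x, (l, i)) :: staircase_shift l.+1 s); split.
- apply: staircase_cons_shift => //.
  rewrite -[d' * x]opprK; apply: unitB_ideal_xy uU _.
  exact: (idealN ideal_xyW (idealMl ideal_xyW _ ideal_xy_x)).
- rewrite /= lt_ij all_map /=; apply: sub_all si => t' /= lt_t'.
  exact: ltn_trans lt_t' lt_ij.
rewrite c'E /staircase_sum big_cons -/(staircase_sum _) staircase_sum_shift tE.
by rewrite /monomial /= exprS; ring.
Qed.

Lemma staircase_exists f : f != 0 ->
  exists s, staircase s /\ f = staircase_sum s.
Proof.
move=> f0.
have [l [_ [c [[d ->] -> nc]]]] : exists l j e, [/\ principal 0 j,
    f = j + x ^+ l * e & ~ add_principal (principal 0) x e].
  apply: add_principal_factor => //; first exact: ideal_principal.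
    exact: (inv_1B_ideal_xy ideal_xy_x).
  by move=> [e fE]; rewrite fE mul0r eqxx in f0.
have [|u [i [t [uU cE]]]] := @mod_x_normal_form c.
  move=> [e cE]; apply: nc; exists 0, e; rewrite cE; split; last by ring.
  exact: (ideal0 (ideal_principal _)).
have [d' [s [sS si tE]]] := staircase_mod_y i t.
exists ((u + d' * x, (l, i)) :: staircase_shift l.+1 s); split.
  apply: staircase_cons_shift => //.
  rewrite -[d' * x]opprK; apply: unitB_ideal_xy uU _.
  exact: (idealN ideal_xyW (idealMl ideal_xyW _ ideal_xy_x)).
rewrite cE /staircase_sum big_cons -/(staircase_sum _) staircase_sum_shift tE.
by rewrite /monomial /= exprS; ring.
Qed.

Lemma monomial_rep_exists f : f != 0 ->
  exists n (u : 'I_n -> D) (e : 'I_n -> nat * nat), monomial_rep x y f u e.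
Proof.
move=> /staircase_exists [s [/andP [sU sP] ->]].
pose t i := nth (0, (0, 0)%N) s i.
exists (size s), (fun i => (t i).1), (fun i => (t i).2).
have lt_t (i j : 'I_(size s)) : (i < j)%N ->
    ((t i).2.1 < (t j).2.1)%N /\ ((t j).2.2 < (t i).2.2)%N.
  by move=> ij; apply/andP; apply: (pairwiseP _ sP) => //; apply: ltn_ord.
have ndvd (i j : 'I_(size s)) : i != j ->
    ~ exists c, monomial x y (t j).2 = c * monomial x y (t i).2.
  move=> ij [c /monomial_dvd [le1 le2]].
  have [/lt_t [_]|/lt_t []|/val_inj/eqP] := ltngtP i j.
  - by rewrite ltnNge le2.
  - by rewrite ltnNge le1.
  - by rewrite (negPf ij).
split=> //.
- by move=> i; apply: (allP sU); apply: mem_nth.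
- move=> i j E; apply/eqP/negPn/negP => /ndvd; apply.
  by exists 1; rewrite mul1r.
- by rewrite /staircase_sum (big_nth (0, (0, 0)%N)) big_mkord.
Qed.

End RegularLocalRing.
(** * Leading monomials *)

Section LeadingMonomial.
Variables (R : realType) (D : idomainType) (x y : D).
Hypothesis reg : regular_local_ring [tuple x; y].
Variables (r : R) (r0 : 0 < r).
Implicit Types (J : set D) (e : nat * nat) (f g h u : D).

Local Notation weight := (monomial_weight r).
Local Notation mon := (monomial x y).

Definition exponent_add e e' := ((e.1 + e'.1)%N, (e.2 + e'.2)%N).

(** Monomials of equal weight are ordered by their x-exponent: v_r is thereby
    refined into a valuation of rank two, for which every element has a single
    leading monomial and leading monomials multiply. *)
Definition exponent_lt e e' :=
  (weight e < weight e') || (weight e == weight e') && (e.1 < e'.1)%N.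

(** Generated by the monomials greater than the one of exponent e.  Written as an
    intersection of ideals, it gets its closure properties by applying the
    definition to suitable ideals. *)
Definition higher_ideal e : set D :=
  [set f | forall J, ideal J -> (forall e', exponent_lt e e' -> J (mon e')) -> J f].

(** Up to a unit, f is the monomial of exponent e plus greater ones. *)
Definition leading f e :=
  exists u, u \is a GRing.unit /\ higher_ideal e (f - u * mon e).

Lemma monomialD e e' : mon (exponent_add e e') = mon e * mon e'.
Proof. by rewrite /monomial /= !exprD; ring. Qed.

Lemma weightD e e' : weight (exponent_add e e') = weight e + weight e'.
Proof. by rewrite /monomial_weight /= !natrD; ring. Qed.

Lemma weight_ge0 e : 0 <= weight e.
Proof. by rewrite addr_ge0 // mulr_ge0 // ltW. Qed.

Lemma exponent_lt_trans e2 e1 e3 :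
  exponent_lt e1 e2 -> exponent_lt e2 e3 -> exponent_lt e1 e3.
Proof.
rewrite /exponent_lt => /orP[lt12|/andP [/eqP -> lt12]] /orP[lt23|/andP [/eqP E lt23]].
- by rewrite (lt_trans lt12 lt23).
- by rewrite -E lt12.
- by rewrite lt23.
- by rewrite E eqxx (ltn_trans lt12 lt23) orbT.
Qed.

Lemma exponent_lt_add2l e e1 e2 :
  exponent_lt e1 e2 -> exponent_lt (exponent_add e e1) (exponent_add e e2).
Proof. by rewrite /exponent_lt !weightD ltrD2l (inj_eq (addrI _)) ltn_add2l. Qed.

Lemma exponent_add_comm e e' : exponent_add e e' = exponent_add e' e.
Proof. by rewrite /exponent_add addnC [(e.2 + _)%N]addnC. Qed.

Lemma exponent_lt_total e e' : e != e' -> exponent_lt e e' \/ exponent_lt e' e.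
Proof.
move=> ne; rewrite /exponent_lt.
have [lt|lt|E] := ltgtP (weight e) (weight e'); [by left|by right|].
have [lt|lt|E1] := ltngtP e.1 e'.1; [by left|by right|].
case/eqP: ne; case: e e' E E1 => [p q] [p' q']; rewrite /monomial_weight /= => E E1.
move: E; rewrite E1 => /addrI /(mulIf (lt0r_neq0 r0)) /eqP.
by rewrite eqr_nat => /eqP ->.
Qed.

Lemma ideal_higher e : ideal (higher_ideal e).
Proof.
split=> [J idJ _|a u v Ju Jv J idJ Jmon]; first exact: ideal0.
by case: (idJ) => _; apply; [apply: Ju | apply: Jv].
Qed.

Lemma higher_mon e e' : exponent_lt e e' -> higher_ideal e (mon e').
Proof. by move=> lt J _; apply. Qed.

Lemma higher_sub e e' : exponent_lt e e' -> higher_ideal e' `<=` higher_ideal e.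
Proof.
move=> lt f Jf J idJ Jmon; apply: Jf => // e'' lt'.
by apply/Jmon/(exponent_lt_trans lt).
Qed.

Lemma ideal_preim_mul J g : ideal J -> ideal [set f | J (g * f)].
Proof.
move=> idJ; split=> [|a u v Ju Jv]; rewrite /mkset; first by rewrite mulr0; apply: ideal0.
by rewrite mulrDr mulrCA; case: (idJ) => _; apply.
Qed.

Lemma higher_mon_mul e e' f :
  higher_ideal e' f -> higher_ideal (exponent_add e e') (mon e * f).
Proof.
move=> Hf J idJ Jmon; apply: (Hf _ (ideal_preim_mul (mon e) idJ)) => e'' lt.
by rewrite /mkset -monomialD; apply/Jmon/exponent_lt_add2l.
Qed.

Lemma higher_mul e e' f g :
  higher_ideal e f -> higher_ideal e' g -> higher_ideal (exponent_add e e') (f * g).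
Proof.
move=> Hf Hg; rewrite mulrC.
apply: (Hf _ (ideal_preim_mul g (ideal_higher _))) => e'' lt; rewrite /mkset mulrC.
apply: (@higher_sub _ (exponent_add e'' e')); last exact: higher_mon_mul.
by rewrite ![exponent_add _ e']exponent_add_comm; apply: exponent_lt_add2l.
Qed.

(** A greater monomial whose x-exponent is at most e.1 has greater weight, hence
    y-exponent greater than e.2. *)
Lemma higher_ideal_pyramid e f : higher_ideal e f ->
  exists a b, f = a * x ^+ e.1.+1 + b * y ^+ e.2.+1.
Proof.
move=> /(_ [set g | exists a b, g = a * x ^+ e.1.+1 + b * y ^+ e.2.+1]).
apply; first split.
- by exists 0, 0; ring.
- move=> a _ _ [c [d ->]] [c' [d' ->]].
  by exists (a * c + c'), (a * d + d'); ring.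
move=> e' lt; have [lt1|le1] := ltnP e.1 e'.1.
  exists (x ^+ (e'.1 - e.1.+1) * y ^+ e'.2), 0.
  by rewrite /monomial -{1}(subnK lt1) exprD; ring.
have lt2 : (e.2 < e'.2)%N.
  move: lt; rewrite /exponent_lt [(e.1 < _)%N]ltnNge le1 andbF orbF /monomial_weight.
  move=> lt; rewrite -(ltr_nat R) -(ltr_pM2r r0).
  move: le1; rewrite -(ler_nat R) => le1; lra.
exists 0, (x ^+ e'.1 * y ^+ (e'.2 - e.2.+1)).
by rewrite /monomial -{1}(subnK lt2) exprD; ring.
Qed.

Lemma leading_notin_higher f e : leading f e -> ~ higher_ideal e f.
Proof.
move=> [u [uU Hf]] Hf'; have Hu := idealB (ideal_higher e) Hf' Hf.
have /higher_ideal_pyramid [a [b]] : higher_ideal e (mon e).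
  rewrite -[mon e]mul1r -(mulVr uU) -mulrA; apply: (idealMl (ideal_higher e)).
  by rewrite opprB addrC subrK in Hu.
exact: monomial_notin_pyramid.
Qed.

Lemma higher_of_leading f e e' : leading f e' -> exponent_lt e e' -> higher_ideal e f.
Proof.
move=> [u [_ Hf]] lt; rewrite -[f](subrK (u * mon e')).
apply: (idealD (ideal_higher e)); first exact: (higher_sub lt Hf).
exact: (idealMl (ideal_higher e) _ (higher_mon lt)).
Qed.

Lemma leading_not_lt f e e' : leading f e -> leading f e' -> ~~ exponent_lt e e'.
Proof.
move=> fe fe'; apply/negP => lt.
exact: leading_notin_higher fe (higher_of_leading fe' lt).
Qed.

Lemma leading_unique f e e' : leading f e -> leading f e' -> e = e'.
Proof.
move=> fe fe'; apply/eqP/negPn/negP => /exponent_lt_total [] lt.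
  by have := leading_not_lt fe fe'; rewrite lt.
by have := leading_not_lt fe' fe; rewrite lt.
Qed.

Lemma leading_mul f g e e' :
  leading f e -> leading g e' -> leading (f * g) (exponent_add e e').
Proof.
move=> [u [uU Hf]] [v [vU Hg]]; exists (u * v); split; first by rewrite unitrM uU.
set f' := f - _ in Hf; set g' := g - _ in Hg.
have idH := ideal_higher (exponent_add e e').
have -> : f * g - u * v * mon (exponent_add e e') =
  u * (mon e * g') + (v * (mon e' * f') + f' * g').
  by rewrite monomialD /f' /g'; ring.
apply: (idealD idH); first exact: (idealMl idH _ (higher_mon_mul Hg)).
apply: (idealD idH); last exact: higher_mul.
by apply: (idealMl idH); rewrite exponent_add_comm; apply: higher_mon_mul.
Qed.

Lemma leading_add f g e e' e'' :
    leading f e -> leading g e' -> leading (f + g) e'' ->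
  Num.min (weight e) (weight e') <= weight e''.
Proof.
move=> fe ge' fge''; rewrite leNgt lt_min; apply/negP => /andP [lt lt'].
apply: (leading_notin_higher fge''); apply: (idealD (ideal_higher _)).
  by apply: (higher_of_leading fe); rewrite /exponent_lt lt.
by apply: (higher_of_leading ge'); rewrite /exponent_lt lt'.
Qed.

Lemma leading_unit f : f \is a GRing.unit -> leading f (0, 0)%N.
Proof.
move=> fU; exists f; split=> //; rewrite /monomial /= !mulr1 subrr.
exact: (ideal0 (ideal_higher _)).
Qed.

Lemma leading_nonunit f e : f \isn't a GRing.unit -> leading f e -> 0 < weight e.
Proof.
move=> fNu fe; rewrite lt_def weight_ge0 andbT; apply/eqP => we0.
have {we0} e0 : e = (0, 0)%N.
  apply/eqP/negPn/negP => /exponent_lt_total; rewrite /exponent_lt we0.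
  rewrite /monomial_weight /= mul0r addr0 ltxx eqxx /= ltn0.
  case=> // e1; move: we0; rewrite /monomial_weight => /eqP.
  by rewrite paddr_eq0 ?mulr_ge0 ?(ltW r0) // pnatr_eq0 -leqn0 leqNgt e1.
have [u [uU]] := fe; rewrite e0 /monomial /= !mulr1.
move=> /higher_ideal_pyramid [a [b /= E]]; case/negP: fNu.
rewrite -[f](subrK u) addrC -[f - u]opprK; apply: (unitB_ideal_xy reg) => //.
rewrite E; exists (x * - a), (- b); split; last by rewrite !expr1; ring.
by exists (- a).
Qed.

(** * Values of monomial representations *)

(** The index has minimal weight, and minimal x-exponent among those. *)
Lemma rep_arg_min f n (u : 'I_n -> D) (e : 'I_n -> nat * nat) :
    f != 0 -> monomial_rep x y f u e ->
  exists i, leading f (e i) /\ forall j, weight (e i) <= weight (e j).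
Proof.
move=> f0 [uU einj _ fE]; have {}einj : injective e.
  by move=> i j E; apply: einj; rewrite E.
have [i0 _] : exists i : 'I_n, true.
  case: n u e uU einj fE => [|n] u e _ _ E; last by exists ord0.
  by rewrite E big_ord0 eqxx in f0.
case: (arg_minP (fun i => weight (e i)) (erefl : predT i0)) => i1 _ i1min.
have wmin j : weight (e i1) <= weight (e j) by apply: i1min.
case: (@arg_minnP _ i1 (fun i => weight (e i) == weight (e i1)) (fun i => (e i).1)) => //.
move=> i /eqP wi xmin.
have imin j : j != i -> exponent_lt (e i) (e j).
  move=> ji; have [|//|] := @exponent_lt_total (e i) (e j).
    by apply: contra ji => /eqP /einj ->.
  move=> /orP [|/andP [/eqP wj]]; first by rewrite wi ltNge wmin.
  by rewrite ltnNge xmin // wj wi.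
exists i; split=> [|j]; last first.
  have [->//|/imin] := eqVneq j i.
  by move=> /orP[/ltW //|/andP [/eqP ->]].
exists (u i); split=> //; rewrite fE (bigD1 i) //= addrAC subrr add0r.
apply: ideal_sum; first exact: ideal_higher.
move=> j /imin lt; exact: (idealMl (ideal_higher _) _ (higher_mon lt)).
Qed.

End LeadingMonomial.

(** * The monomial valuations *)

Section MonomialValuation.
Variables (R : realType) (D : idomainType) (x y : D).
Hypothesis reg : regular_local_ring [tuple x; y].
Implicit Types (r : R) (f g : D) (z t : {fraction D}).

Local Notation "f %:F" := (@FracField.tofrac D f).
Local Notation vE := (monomial_valuation_dom x y).

(** Real-valued versions of the valuations, meaningful for nonzero arguments. *)
Definition dom_val r f : R := fine (vE r f).
Definition frac_val r z : R := dom_val r \n_(repr z) - dom_val r \d_(repr z).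

Lemma rep_value_min r f n (u : 'I_n -> D) (e : 'I_n -> nat * nat) :
    0 < r -> f != 0 -> monomial_rep x y f u e ->
  exists i, [/\ leading x y r f (e i), vE r f = (monomial_weight r (e i))%:E &
    forall j, monomial_weight r (e i) <= monomial_weight r (e j)].
Proof.
move=> r0 f0 fue.
have rep_min n' (u' : 'I_n' -> D) (e' : 'I_n' -> nat * nat) :
    monomial_rep x y f u' e' -> exists i, [/\ leading x y r f (e' i),
      \big[Order.min/+oo%E]_(k < n') (monomial_weight r (e' k))%:E =
        (monomial_weight r (e' i))%:E &
      forall j, monomial_weight r (e' i) <= monomial_weight r (e' j)].
  move=> rep; have [i [fi imin]] := rep_arg_min r0 f0 rep; exists i; split=> //.
  apply/eqP; rewrite eq_le; apply/andP; split.
    by apply/bigmin_leP; right; exists i.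
  by apply: le_bigmin => [|j _]; [rewrite leey | rewrite lee_fin].
have [i [fi wE imin]] := rep_min _ _ _ fue; exists i; split=> //.
rewrite /monomial_valuation_dom (negPf f0); apply: xget_unique.
  by exists n, u, e; rewrite wE.
move=> _ [n' [u' [e' [fue' ->]]]]; have [i' [fi' -> _]] := rep_min _ _ _ fue'.
by rewrite (leading_unique reg r0 fi fi').
Qed.

Lemma dom_val_leading r f : 0 < r -> f != 0 ->
  exists e, [/\ leading x y r f e, vE r f = (dom_val r f)%:E &
                dom_val r f = monomial_weight r e].
Proof.
move=> r0 f0; have [n [u [e fue]]] := monomial_rep_exists reg f0.
have [i [fi fE _]] := rep_value_min r0 f0 fue.
by exists (e i); rewrite /dom_val fE.
Qed.

Lemma leading_dom_val r f e : 0 < r -> f != 0 -> leading x y r f e ->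
  dom_val r f = monomial_weight r e.
Proof.
move=> r0 f0 fe; have [e' [fe' _ ->]] := dom_val_leading r0 f0.
by rewrite (leading_unique reg r0 fe fe').
Qed.

Lemma dom_valM r f g : 0 < r -> f != 0 -> g != 0 ->
  dom_val r (f * g) = dom_val r f + dom_val r g.
Proof.
move=> r0 f0 g0; have [e [fe _ ->]] := dom_val_leading r0 f0.
have [e' [ge' _ ->]] := dom_val_leading r0 g0.
by rewrite (leading_dom_val _ _ (leading_mul fe ge')) ?mulf_neq0 // weightD.
Qed.

Lemma dom_valD r f g : 0 < r -> f != 0 -> g != 0 -> f + g != 0 ->
  Num.min (dom_val r f) (dom_val r g) <= dom_val r (f + g).
Proof.
move=> r0 f0 g0 fg0; have [e [fe _ ->]] := dom_val_leading r0 f0.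
have [e' [ge' _ ->]] := dom_val_leading r0 g0.
have [e'' [fge _ ->]] := dom_val_leading r0 fg0.
exact: leading_add fe ge' fge.
Qed.

Lemma dom_val_ge0 r f : 0 < r -> f != 0 -> 0 <= dom_val r f.
Proof. by move=> r0 /(dom_val_leading r0) [e [_ _ ->]]; apply: weight_ge0. Qed.

Lemma dom_val_unit r f : 0 < r -> f \is a GRing.unit -> dom_val r f = 0.
Proof.
move=> r0 fU; have f0 : f != 0 by apply: contraTneq fU => ->; rewrite unitr0.
rewrite (leading_dom_val r0 f0 (leading_unit x y r fU)).
by rewrite /monomial_weight mul0r addr0.
Qed.

Lemma dom_val_nonunit r f : 0 < r -> f != 0 -> f \isn't a GRing.unit ->
  0 < dom_val r f.
Proof.
move=> r0 f0 fNu; have [e [fe _ ->]] := dom_val_leading r0 f0.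
exact: leading_nonunit fe.
Qed.

(** The monomials of one representation of f serve for all r, and their weights
    are affine functions of r. *)
Lemma dom_val_lipschitz f : f != 0 -> exists2 L : R, 0 <= L & forall r r', 0 < r -> 0 < r' ->
  dom_val r f <= dom_val r' f + L * `|r - r'|.
Proof.
move=> f0; have [n [u [e fue]]] := monomial_rep_exists reg f0.
exists (\sum_i (e i).2)%:R => // r r' r0 r'0.
have [i [_ fE imin]] := rep_value_min r0 f0 fue.
have [i' [_ f'E _]] := rep_value_min r'0 f0 fue.
rewrite /dom_val fE f'E /=; apply: le_trans (imin i') _.
have -> : monomial_weight r (e i') =
    monomial_weight r' (e i') + (e i').2%:R * (r - r').
  by rewrite /monomial_weight; ring.
rewrite lerD2l; apply: le_trans (ler_wpM2l _ (ler_norm _)) _ => //.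
by rewrite ler_wpM2r // ler_nat (bigD1 i') //= leq_addr.
Qed.

Lemma fracE z : z * (\d_(repr z))%:F = (\n_(repr z))%:F.
Proof.
rewrite -{1}[z]reprK; unlock FracField.tofrac; rewrite -[LHS]FracField.pi_mul.
apply/eqP; rewrite FracField.equivf_def /FracField.mulf.
by rewrite !numden_Ratio ?mulr1 ?oner_neq0 ?denom_ratioP // mulrC.
Qed.

Lemma num_eq0 z : (\n_(repr z) == 0) = (z == 0).
Proof.
rewrite -tofrac_eq0 -fracE mulf_eq0 tofrac_eq0.
by rewrite (negPf (denom_ratioP _)) orbF.
Qed.

Lemma frac_valE r z f g : 0 < r -> f != 0 -> g != 0 -> z * g%:F = f%:F ->
  frac_val r z = dom_val r f - dom_val r g.
Proof.
move=> r0 f0 g0 zE; have d0 := denom_ratioP (repr z).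
have n0 : \n_(repr z) != 0.
  by rewrite num_eq0; apply: contraNneq f0 => z0; rewrite -tofrac_eq0 -zE z0 mul0r.
have : \n_(repr z) * g = \d_(repr z) * f.
  by apply/eqP; rewrite -tofrac_eq !tofracM -fracE -zE; apply/eqP; ring.
move=> /(congr1 (dom_val r)); rewrite !dom_valM // /frac_val; lra.
Qed.

Lemma frac_val_tofrac r f : 0 < r -> f != 0 -> frac_val r f%:F = dom_val r f.
Proof.
move=> r0 f0; rewrite (@frac_valE _ _ f 1) ?oner_neq0 //.
  by rewrite (dom_val_unit r0 (unitr1 _)) subr0.
by rewrite tofrac1 mulr1.
Qed.

Lemma frac_valM r z t : 0 < r -> z != 0 -> t != 0 ->
  frac_val r (z * t) = frac_val r z + frac_val r t.
Proof.
move=> r0 z0 t0; have [dz dt] := (denom_ratioP (repr z), denom_ratioP (repr t)).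
rewrite (@frac_valE _ _ (\n_(repr z) * \n_(repr t)) (\d_(repr z) * \d_(repr t))).
- by rewrite !dom_valM ?num_eq0 // /frac_val; ring.
- by [].
- by rewrite mulf_neq0 // num_eq0.
- by rewrite mulf_neq0.
- by rewrite !tofracM -!fracE; ring.
Qed.

Lemma frac_valD r z t : 0 < r -> z != 0 -> t != 0 -> z + t != 0 ->
  Num.min (frac_val r z) (frac_val r t) <= frac_val r (z + t).
Proof.
move=> r0 z0 t0 zt0; have [dz dt] := (denom_ratioP (repr z), denom_ratioP (repr t)).
pose f := \n_(repr z) * \d_(repr t); pose g := \n_(repr t) * \d_(repr z).
have E : (z + t) * (\d_(repr z) * \d_(repr t))%:F = (f + g)%:F.
  by rewrite tofracD !tofracM -!fracE; ring.
have f0 : f != 0 by rewrite mulf_neq0 // num_eq0.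
have g0 : g != 0 by rewrite mulf_neq0 // num_eq0.
have d0 : \d_(repr z) * \d_(repr t) != 0 by rewrite mulf_neq0.
have fg0 : f + g != 0 by rewrite -tofrac_eq0 -E mulf_neq0 ?tofrac_eq0.
rewrite (frac_valE r0 fg0 d0 E); have := dom_valD r0 f0 g0 fg0.
rewrite !dom_valM ?num_eq0 // /frac_val !ge_min => /orP [] le.
  by apply/orP; left; lra.
by apply/orP; right; lra.
Qed.

Lemma frac_val_lipschitz z : z != 0 -> exists2 L : R, 0 <= L & forall r r',
  0 < r -> 0 < r' -> frac_val r z <= frac_val r' z + L * `|r - r'|.
Proof.
move=> z0; have [|L L0 nL] := @dom_val_lipschitz \n_(repr z); first by rewrite num_eq0.
have [L' L'0 dL] := dom_val_lipschitz (denom_ratioP (repr z)).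
exists (L + L') => [|r r' r0 r'0]; first exact: addr_ge0.
have := nL r r' r0 r'0; have := dL r' r r'0 r0; rewrite distrC /frac_val; lra.
Qed.

Lemma monomial_valuation_ringP r z : 0 < r ->
  z \in monomial_valuation_ring x y r <-> (z != 0 -> 0 <= frac_val r z).
Proof.
move=> r0; have d0 := denom_ratioP (repr z).
have [e [_ dE _]] := dom_val_leading r0 d0.
rewrite inE /monomial_valuation dE; have [z0|z0] := eqVneq z 0.
  have /eqP -> : \n_(repr z) == 0 by rewrite num_eq0 z0.
  by rewrite /monomial_valuation_dom eqxx /= leey; split.
have n0 : \n_(repr z) != 0 by rewrite num_eq0.
have [e' [_ nE _]] := dom_val_leading r0 n0.
by rewrite nE -EFinB lee_fin; split=> [|/(_ isT)].
Qed.

End MonomialValuation.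
(** * Extension of valuations *)

Section Chevalley.
Variable K : fieldType.
Implicit Types (B : set K) (p q : {poly K}) (u v w z : K).

Definition subring_set B :=
  [/\ B 1, forall u v, B u -> B v -> B (u - v) & forall u v, B u -> B v -> B (u * v)].

Section SubringSet.
Variables (B : set K) (subB : subring_set B).

Lemma subringB u v : B u -> B v -> B (u - v). Proof. by case: subB => _ + _; apply. Qed.
Lemma subringM u v : B u -> B v -> B (u * v). Proof. by case: subB => _ _; apply. Qed.
Lemma subring1 : B 1. Proof. by case: subB. Qed.
Lemma subring0 : B 0. Proof. by rewrite -(subrr 1); apply: subringB; apply: subring1. Qed.
Lemma subringN u : B u -> B (- u).
Proof. by rewrite -sub0r; apply: subringB subring0. Qed.
Lemma subringD u v : B u -> B v -> B (u + v).
Proof. by rewrite -[v in u + v]opprK => Bu /subringN; apply: subringB. Qed.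
Lemma subringX u n : B u -> B (u ^+ n).
Proof.
by move=> Bu; elim: n => [|n IH]; rewrite ?exprS; [exact: subring1 | exact: subringM].
Qed.
Lemma subring_sum I (s : seq I) (Q : pred I) (F : I -> K) :
  (forall i, Q i -> B (F i)) -> B (\sum_(i <- s | Q i) F i).
Proof. by move=> BF; elim/big_ind: _ => //; [exact: subring0 | exact: subringD]. Qed.

End SubringSet.

Definition coefs_in B p := forall i, B p`_i.

Definition adjoin B u : set K := [set w | exists p, coefs_in B p /\ w = p.[u]].

Lemma coefs_in_polyC B c : subring_set B -> B c -> coefs_in B c%:P.
Proof. by move=> subB Bc i; rewrite coefC; case: ifP => // _; apply: subring0. Qed.

Lemma subring_adjoin B u : subring_set B -> subring_set (adjoin B u).
Proof.
move=> subB; split=> [|_ _ [p [pB ->]] [q [qB ->]]|_ _ [p [pB ->]] [q [qB ->]]].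
- exists 1%:P; rewrite hornerC; split=> //; exact: (coefs_in_polyC subB (subring1 subB)).
- exists (p - q); rewrite !hornerE; split=> // i; rewrite coefB.
  exact: (subringB subB (pB i) (qB i)).
- exists (p * q); rewrite hornerM; split=> // i; rewrite coefM.
  by apply: subring_sum => // j _; exact: (subringM subB (pB j) (qB _)).
Qed.

Lemma adjoin_sub B u : subring_set B -> B `<=` adjoin B u.
Proof.
by move=> subB c Bc; exists c%:P; rewrite hornerC; split=> //; apply: coefs_in_polyC.
Qed.

Lemma adjoin_gen B u : subring_set B -> adjoin B u u.
Proof.
move=> subB; exists 'X; rewrite hornerX; split=> // i; rewrite coefX.
by case: eqP => _; [apply: subring1 | apply: subring0].
Qed.

Section MaximalSubring.
Variables (B : set K) (z : K).
Hypotheses (subB : subring_set B) (Bz : B z) (nBz : ~ B z^-1).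
Hypothesis maxB : forall B', B `<=` B' -> subring_set B' -> ~ B' z^-1 -> B' `<=` B.

Let z_neq0 : z != 0.
Proof. by apply/eqP => z0; apply: nBz; rewrite z0 invr0; apply: subring0. Qed.

Lemma maximal_adjoin u : ~ B u -> adjoin B u z^-1.
Proof.
move=> nBu; apply: contrapT => nz; apply: nBu.
apply: (maxB _ _ nz); [exact: adjoin_sub | exact: subring_adjoin | exact: adjoin_gen].
Qed.

(** Thus z lies in the Jacobson radical of B.  If w = 1 - z b had no inverse in B,
    then z^-1 would be a polynomial in w^-1, so w^n z^-1 would be in B for some
    n; but w^n is 1 modulo z. *)
Lemma maximal_inv1B b : B b -> B (1 - z * b)^-1.
Proof.
move=> Bb; set w := 1 - z * b.
have Bw : B w by apply: subringB (subring1 subB) (subringM subB Bz Bb).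
have w0 : w != 0.
  apply/eqP => /eqP; rewrite subr_eq0 => /eqP zb; apply: nBz.
  by rewrite -[z^-1]mulr1 zb mulKf.
apply: contrapT => /maximal_adjoin [p [pB zE]]; apply: nBz.
have [n [Bwn [b' [Bb' wnE]]]] : exists n, B (w ^+ n * z^-1) /\
    exists b', B b' /\ w ^+ n = 1 - z * b'.
  exists (size p); split.
    rewrite zE horner_coef mulr_sumr; apply: subring_sum => // i _.
    have -> : w ^+ size p * (p`_i * w^-1 ^+ i) = p`_i * w ^+ (size p - i).
      rewrite expfB_cond ?(negPf w0) ?add0n 1?ltnW // exprVn; ring.
    exact: (subringM subB (pB i) (subringX subB _ Bw)).
  elim: (size p) => [|k [b' [Bb' IH]]]; first by exists 0; split; [exact: subring0 | ring].
  exists (b + b' - z * (b * b')); split; last by rewrite exprS IH /w; ring.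
  apply: subringB => //; first exact: subringD.
  by apply: subringM => //; apply: subringM.
have -> : z^-1 = w ^+ n * z^-1 + b' by rewrite wnE; field.
exact: subringD.
Qed.

(** The element z becomes invertible in B[u], with inverse of degree at most n. *)
Definition inverse_relation u n :=
  exists p, [/\ coefs_in B p, (size p <= n.+1)%N & z * p.[u] = 1].

(** If 1 = z q(u^-1), then u^n is a combination of lower powers of u with
    coefficients in z B, since 1 - z q(0) is a unit of B. *)
Lemma inverse_relation_descent u n m : u != 0 -> (m <= n.+1)%N ->
    inverse_relation u n.+1 -> inverse_relation u^-1 m ->
  inverse_relation u n.
Proof.
move=> u0 le_mn [p [pB ps pE]] [q [qB qs qE]].
set N := n.+1 in le_mn ps *; set w := 1 - z * q`_0.
have Bw : B w^-1 by apply: maximal_inv1B.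
have w0 : w != 0.
  apply/eqP => /eqP; rewrite subr_eq0 => /eqP zq; apply: nBz.
  by rewrite -[z^-1]mulr1 zq mulKf.
have qs' : (size q <= N.+1)%N by apply: leq_trans qs _.
exists (\poly_(i < N) (p`_i + p`_N * z * w^-1 * q`_(N - i))); split.
- move=> i; rewrite coef_poly; case: ifP => _; last exact: subring0.
  exact: (subringD subB (pB i) (subringM subB
      (subringM subB (subringM subB (pB N) Bz) Bw) (qB _))).
- exact: size_poly.
rewrite -[RHS]pE (horner_coef_wide _ ps) big_ord_recr horner_poly /=; congr (z * _).
rewrite (eq_bigr (fun i : 'I_N => p`_i * u ^+ i +
    p`_N * z * w^-1 * (q`_(N - i) * u ^+ i))) => [|i _]; last by ring.
rewrite big_split /= -mulr_sumr; congr (_ + _).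
have -> : \sum_(i < N) q`_(N - i) * u ^+ i = u ^+ N * (q.[u^-1] - q`_0).
  have -> : q.[u^-1] = q`_0 + \sum_(i < N) q`_i.+1 * u^-1 ^+ i.+1.
    by rewrite (horner_coef_wide _ qs') big_ord_recl expr0 mulr1.
  rewrite addrAC subrr add0r.
  rewrite (reindex_inj rev_ord_inj) mulr_sumr; apply: eq_bigr => i _ /=.
  have -> : (N - (N - i.+1) = i.+1)%N by rewrite subKn.
  rewrite expfB_cond ?(negPf u0) ?add0n // exprVn; ring.
have -> : q.[u^-1] - q`_0 = w / z.
  by apply: (mulfI z_neq0); rewrite mulrBr qE [RHS]mulrC divfK.
by field; rewrite z_neq0.
Qed.

(** Otherwise z would be invertible both in B[u] and in B[u^-1], and the two
    relations would reduce each other's degree indefinitely. *)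
Lemma maximal_subring_valuation u : u != 0 -> B u \/ B u^-1.
Proof.
move=> u0; apply: contrapT => /not_orP [nBu nBu'].
have rel v : ~ B v -> exists n, inverse_relation v n.
  move=> /maximal_adjoin [p [pB pE]]; exists (size p), p.
  by rewrite -pE divff.
have rel0 v : ~ inverse_relation v 0.
  move=> [p [pB /size1_polyC ->]]; rewrite hornerC => zp; apply: nBz.
  by rewrite -[z^-1]mulr1 -zp mulKf.
have [[n relu] [m relu']] := (rel _ nBu, rel _ nBu').
have [N] := ubnP (n + m); elim: N => // N IH in u u0 n m relu relu' {nBu nBu'} *.
have [le_mn|lt_nm] := leqP m n.
  case: n le_mn relu => [_ /rel0 //|n] le_mn relu; rewrite addSn ltnS.
  exact/IH/relu'/(inverse_relation_descent u0 le_mn relu relu').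
case: m lt_nm relu' => // m lt_nm relu'; rewrite addnS ltnS.
have u'0 : u^-1 != 0 by rewrite invr_eq0.
have relu'' : inverse_relation u^-1^-1 n by rewrite invrK.
exact/(IH _ u0 _ _ relu)/(inverse_relation_descent u'0 (ltnW lt_nm) relu' relu'').
Qed.

End MaximalSubring.

(** Chevalley's extension theorem: V is a maximal subring among those that contain
    B and do not contain z^-1. *)
Lemma valuation_subring_avoiding B z : subring_set B -> B z -> ~ B z^-1 ->
  exists V : {pred K}, [/\ valuation_subring V, forall u, B u -> u \in V &
                           z^-1 \notin V].
Proof.
move=> subB Bz nBz.
pose Q := [set B' | [/\ subring_set B', B' z & ~ B' z^-1]].
have QB : Q B by [].
have [F FQ [X0 FX0] totF|M [BM [subM Mz nMz] maxM]] := zorn_extension QB.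
  have FP X : F X -> [/\ subring_set X, X z & ~ X z^-1] by apply: FQ.
  have [subX0 X0z _] := FP _ FX0.
  split; [split=> [|u v Fu Fv|u v Fu Fv] | by exists X0 |].
  - by exists X0 => //; apply: subring1.
  - have [X [FX Xu Xv]] := chain_bigcup2 totF Fu Fv.
    by have [subX _ _] := FP _ FX; exists X => //; apply: subringB.
  - have [X [FX Xu Xv]] := chain_bigcup2 totF Fu Fv.
    by have [subX _ _] := FP _ FX; exists X => //; apply: subringM.
  - by move=> [X FX Xz]; have [_ _] := FP _ FX.
exists (mem M : {pred K}); split=> [|u Bu|]; last by apply/negP => /set_mem.
  split=> [|u u0]; first split=> [|u v /set_mem Mu /set_mem Mv|u v /set_mem Mu /set_mem Mv].
  - exact: (mem_set (subring1 subM)).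
  - exact: (mem_set (subringB subM Mu Mv)).
  - exact: (mem_set (subringM subM Mu Mv)).
  - have [] := maximal_subring_valuation subM Mz nMz _ u0.
    + by move=> B' MB' subB' nB'; apply: maxM => //; split=> //; apply: MB'.
    + by move=> /mem_set; left.
    + by move=> /mem_set; right.
exact/mem_set/BM.
Qed.

End Chevalley.
(** * A local-to-global principle on a real interval *)

(** The supremum of the t with Q a t is attained and equal to b.  The
    principle does the work of connectedness and of compactness of [a, b]. *)
Lemma interval_additive (R : realType) (Q : R -> R -> Prop) (a b : R) : a <= b ->
    (forall c d e, a <= c <= d -> d <= e <= b -> Q c d -> Q d e -> Q c e) ->
    (forall t, a <= t <= b -> exists2 delta : R, 0 < delta &
       forall c d, a <= c <= t -> t <= d <= b -> d - c < delta -> Q c d) ->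
  Q a b.
Proof.
move=> ab Qadd Qloc.
pose E : set R := [set t | a <= t <= b /\ Q a t].
have Ea : E a.
  have [|delta d0 Qd] := Qloc a; first by rewrite lexx.
  by split; [rewrite lexx | apply: Qd; rewrite ?lexx ?ab // subrr].
have Eb : ubound E b by move=> t [/andP []].
have supE : has_sup E by split; [exists a | exists b].
have as_ : a <= sup E by apply: sup_upper_bound.
have sb : sup E <= b by apply: ge_sup => //; exists a.
have [|delta d0 Qd] := Qloc (sup E); first by rewrite as_.
have d2 : 0 < delta / 2 by lra.
have [t [/andP [at_ tb] Qt] st] := sup_adherent d2 supE.
have ts : t <= sup E by apply: sup_upper_bound => //; split=> //; rewrite at_.
have [d [sd db ds dV]] : exists d, [/\ sup E <= d, d <= b, d <= sup E + delta / 3 &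
    d = b \/ d = sup E + delta / 3].
  have [le|lt] := leP b (sup E + delta / 3); first by exists b; split=> //; left.
  by exists (sup E + delta / 3); split=> //; [lra | lra | right].
have Qad : Q a d.
  apply: Qadd Qt _; rewrite ?lexx ?at_ ?(le_trans ts sd) //.
  by apply: Qd; rewrite ?at_ ?ts ?sd //; lra.
have dE : d <= sup E.
  by apply: sup_upper_bound => //; split=> //; rewrite db andbT (le_trans as_).
have [<- //|] := dV; lra.
Qed.

(** * Real valuations of a field *)

Section RealValuation.
Variables (R : realType) (K : fieldType) (v : K -> R).
Implicit Types (z t : K).

Definition real_valuation :=
  (forall z t, z != 0 -> t != 0 -> v (z * t) = v z + v t) /\
  (forall z t, z != 0 -> t != 0 -> z + t != 0 -> Num.min (v z) (v t) <= v (z + t)).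

Hypothesis vP : real_valuation.

(** The valuation ring and its maximal ideal; both contain 0, at which v has no
    meaning. *)
Definition nonneg_val : set K := [set z | z != 0 -> 0 <= v z].
Definition pos_val : set K := [set z | z != 0 -> 0 < v z].

Lemma rvalM z t : z != 0 -> t != 0 -> v (z * t) = v z + v t.
Proof. exact: vP.1. Qed.

Lemma rval1 : v 1 = 0.
Proof. by have := rvalM (oner_neq0 K) (oner_neq0 K); rewrite mulr1; lra. Qed.

Lemma rvalV z : z != 0 -> v z^-1 = - v z.
Proof.
by move=> z0; have := rvalM z0 (invr_neq0 z0); rewrite divff // rval1; lra.
Qed.

Lemma rvalX z n : z != 0 -> v (z ^+ n) = v z *+ n.
Proof.
move=> z0; elim: n => [|n IH]; first by rewrite rval1.
by rewrite exprS rvalM ?expf_neq0 // IH mulrS.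
Qed.

Lemma rvalN z : z != 0 -> v (- z) = v z.
Proof.
move=> z0; have m10 : (-1 : K) != 0 by rewrite oppr_eq0 oner_neq0.
have := rvalM m10 m10; rewrite mulrNN mulr1 rval1 => vm1.
by rewrite -mulN1r rvalM //; lra.
Qed.

Lemma pos_nonneg : pos_val `<=` nonneg_val.
Proof. by move=> z vz /vz /ltW. Qed.

Lemma pos_val0 : pos_val 0. Proof. by rewrite /pos_val /mkset eqxx. Qed.

Lemma pos_val1 : ~ pos_val 1.
Proof. by move=> /(_ (oner_neq0 K)); rewrite rval1 ltxx. Qed.

Lemma nonneg_val1 : nonneg_val 1. Proof. by rewrite /nonneg_val /mkset rval1. Qed.

Lemma pos_valN z : pos_val z -> pos_val (- z).
Proof. by rewrite /pos_val /mkset oppr_eq0 => vz z0; rewrite rvalN // vz. Qed.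

Lemma nonneg_valN z : nonneg_val z -> nonneg_val (- z).
Proof. by rewrite /nonneg_val /mkset oppr_eq0 => vz z0; rewrite rvalN // vz. Qed.

Lemma pos_valD z t : pos_val z -> pos_val t -> pos_val (z + t).
Proof.
have [->|z0] := eqVneq z 0; first by rewrite add0r.
have [->|t0] := eqVneq t 0; first by rewrite addr0.
move=> /(_ z0) vz /(_ t0) vt zt0; have := vP.2 _ _ z0 t0 zt0.
by apply: lt_le_trans; rewrite lt_min vz.
Qed.

Lemma nonneg_valD z t : nonneg_val z -> nonneg_val t -> nonneg_val (z + t).
Proof.
have [->|z0] := eqVneq z 0; first by rewrite add0r.
have [->|t0] := eqVneq t 0; first by rewrite addr0.
move=> /(_ z0) vz /(_ t0) vt zt0; have := vP.2 _ _ z0 t0 zt0.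
by apply: le_trans; rewrite le_min vz.
Qed.

Lemma pos_valM z t : nonneg_val z -> pos_val t -> pos_val (z * t).
Proof.
move=> vz vt; rewrite /pos_val /mkset mulf_eq0 negb_or => /andP [z0 t0].
by rewrite rvalM // ltr_wpDl ?vz ?vt.
Qed.

Lemma nonneg_valM z t : nonneg_val z -> nonneg_val t -> nonneg_val (z * t).
Proof.
move=> vz vt; rewrite /nonneg_val /mkset mulf_eq0 negb_or => /andP [z0 t0].
by rewrite rvalM // addr_ge0 ?vz ?vt.
Qed.

Lemma nonneg_val_subring : subring_set nonneg_val.
Proof.
split=> [|z t vz /nonneg_valN vt|]; first exact: nonneg_val1.
  exact: nonneg_valD.
exact: nonneg_valM.
Qed.

Lemma nonneg_val_total z : z != 0 -> nonneg_val z \/ nonneg_val z^-1.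
Proof.
move=> z0; have [vz|vz] := leP 0 (v z); first by left.
by right=> _; rewrite rvalV // oppr_ge0 ltW.
Qed.

(** If z is not in V, then z^-1 is, so v(z) <= 0. *)
Lemma pos_val_valuation_subring (V : {pred K}) z : valuation_subring V ->
  (forall t, t \in V -> nonneg_val t) -> pos_val z -> z \in V.
Proof.
move=> [[V1 VB _] Vtot] VO vz; have [->|z0] := eqVneq z 0; first by rewrite -(subrr 1) VB.
have [//|/VO] := Vtot _ z0.
by rewrite /nonneg_val /mkset invr_neq0 // rvalV // oppr_ge0 leNgt vz // => /(_ isT).
Qed.

End RealValuation.

(** * Families of valuations dominating a local ring *)

Section ValuationFamily.
Variables (R : realType) (D : comUnitRingType) (K : fieldType).
Variables (iota : {rmorphism D -> K}) (v : R -> K -> R).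
Implicit Types (r : R) (f g z : K) (c : D) (p q : {poly D}) (V : {pred K}).

Hypothesis v_val : forall r, 0 < r -> real_valuation (v r).
Hypothesis v_nonneg : forall r c, 0 < r -> nonneg_val (v r) (iota c).
Hypothesis v_pos : forall r c, 0 < r -> c \isn't a GRing.unit ->
  pos_val (v r) (iota c).
Hypothesis v_lipschitz : forall z, z != 0 -> exists2 L : R, 0 <= L & forall r r',
  0 < r -> 0 < r' -> v r z <= v r' z + L * `|r - r'|.

Local Notation ev p z := (map_poly iota p).[z].

Definition dominated_by r V :=
  [/\ valuation_subring V, forall c, iota c \in V &
      forall z, z \in V -> nonneg_val (v r) z].

Lemma subring_ev (B : set K) p z : subring_set B ->
  (forall c, B (iota c)) -> B z -> B (ev p z).
Proof.
move=> subB DB Bz; rewrite horner_coef; apply: subring_sum => // i _.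
by rewrite coef_map; exact: (subringM subB (DB _) (subringX subB _ Bz)).
Qed.

Lemma valuation_subring_set V : valuation_subring V -> subring_set [set z | z \in V].
Proof. by move=> [[V1 VB VM] _]; split. Qed.

Definition nonneg_pred r : {pred K} := [pred z | (z != 0) ==> (0 <= v r z)].

Lemma nonneg_predP r z : z \in nonneg_pred r <-> nonneg_val (v r) z.
Proof. by split=> [/implyP|vz]; [|apply/implyP]. Qed.

Lemma nonneg_pred_dominated r : 0 < r -> dominated_by r (nonneg_pred r).
Proof.
move=> r0; have vr := v_val r0; have VE := nonneg_predP r.
have [V1 VB VM] := nonneg_val_subring vr.
split=> [|c|z /VE //]; last exact/VE/v_nonneg.
split=> [|z z0]; last first.
  by have [] := nonneg_val_total vr z0 => /VE; [left | right].
split=> [|u w /VE Vu /VE Vw|u w /VE Vu /VE Vw]; apply/VE.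
- exact: V1.
- exact: VB.
- exact: VM.
Qed.

Section FixedRadius.
Variables (r : R) (r0 : 0 < r).
Let vr : real_valuation (v r) := v_val r0.

Local Notation Ov := (nonneg_val (v r)).
Local Notation Mv := (pos_val (v r)).

(** Otherwise the subring of the z congruent modulo Mv to polynomials in f^-1
    would contain f^-1 but not f; a valuation ring that contains it but not f
    is contained in Ov, because it contains Mv and f / u is in Mv for u outside
    Ov. *)
Lemma congruent_inv_polynomial f : f != 0 -> v r f = 0 ->
    (forall V, dominated_by r V -> f \in V) ->
  exists p, Mv (f - ev p f^-1).
Proof.
move=> f0 vf fV.
have Oinv : Ov f^-1 by move=> _; rewrite rvalV // vf oppr0.
have Oev p : Ov (ev p f^-1).
  apply: (@subring_ev Ov) => //; first exact: nonneg_val_subring.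
  by move=> c; apply: v_nonneg.
pose B : set K := [set z | exists p, Mv (z - ev p f^-1)].
have MB z : Mv z -> B z by exists 0; rewrite rmorph0 horner0 subr0.
have DB c : B (iota c).
  by exists c%:P; rewrite map_polyC hornerC subrr; apply: pos_val0.
have subB : subring_set B.
  split=> [|u w [p Bu] [q Bw]|u w [p Bu] [q Bw]].
  - by rewrite -(rmorph1 iota); apply: DB.
  - exists (p - q); rewrite rmorphB !hornerE.
    have -> : u - w - (ev p f^-1 - ev q f^-1) =
              (u - ev p f^-1) - (w - ev q f^-1) by ring.
    by apply: pos_valD => //; apply: pos_valN.
  - exists (p * q); rewrite rmorphM hornerM.
    have -> : u * w - ev p f^-1 * ev q f^-1 =
      u * (w - ev q f^-1) + ev q f^-1 * (u - ev p f^-1) by ring.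
    apply: pos_valD => //; apply: pos_valM => //.
    rewrite -[u](subrK (ev p f^-1)); apply: nonneg_valD => //.
    exact: pos_nonneg.
have Bf' : B f^-1 by exists 'X; rewrite map_polyX hornerX subrr; apply: pos_val0.
apply: contrapT => nBf; have nBff : ~ B f^-1^-1 by rewrite invrK.
have [V [valV' BV nVf]] := valuation_subring_avoiding subB Bf' nBff.
have [[_ _ VM] _] := valV'.
suff domV : dominated_by r V by move: nVf; rewrite invrK fV.
split=> // [c|u Vu]; first exact/BV/DB.
move=> u0; rewrite leNgt; apply/negP => vu.
suff : f \in V by apply/negP; rewrite -[f]invrK.
rewrite -[f](divfK u0); apply: VM => //; apply/BV/MB => _.
by rewrite rvalM ?invr_eq0 // rvalV // vf sub0r oppr_gt0.
Qed.

(** As v(f) = 0, division by f preserves Mv.  Constant coefficients that are not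
    units lie in Mv, so they can be removed from P, followed by a division by f,
    until the constant coefficient is a unit. *)
Lemma strip_nonunit_coefs f P : f != 0 -> v r f = 0 ->
    lead_coef P \is a GRing.unit -> Mv (ev P f) ->
  exists q, Mv (1 - f * ev q f).
Proof.
move=> f0 vf; elim/poly_ind: P => [|q c IH]; first by rewrite lead_coef0 unitr0.
rewrite rmorphD rmorphM /= map_polyX map_polyC !hornerE => lcU MP.
have [cU|cNu] := boolP (c \is a GRing.unit).
  exists (- c^-1 *: q); rewrite linearZ /= hornerZ rmorphN /=.
  have -> : 1 - f * (- iota c^-1 * ev q f) = iota c^-1 * (ev q f * f + iota c).
    by rewrite mulrDr -rmorphM mulVr // rmorph1; ring.
  by apply: pos_valM => //; apply: v_nonneg.
have [q0|q0] := eqVneq q 0.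
  by move: lcU; rewrite q0 mul0r add0r lead_coefC (negPf cNu).
apply: IH.
  move: lcU; rewrite lead_coefDl ?lead_coefMX // size_mulX // ltnS.
  by rewrite (leq_trans (size_polyC_leq1 c)) // size_poly_gt0.
have -> : ev q f = f^-1 * ((ev q f * f + iota c) - iota c) by field.
apply: pos_valM => //; first by move=> _; rewrite rvalV // vf oppr0.
by apply: pos_valD => //; apply/pos_valN/v_pos.
Qed.

(** Multiplied by f^(n-1), where n is the size of p, the congruence of f and
    p(f^-1) becomes a monic equation P(f) = 0 modulo Mv. *)
Lemma unit_relation f : f != 0 -> v r f = 0 ->
    (forall V, dominated_by r V -> f \in V) ->
  exists q, Mv (1 - f * ev q f).
Proof.
move=> f0 vf fV; have [p Mp] := congruent_inv_polynomial f0 vf fV.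
pose n := size p; pose P := 'X^n - \poly_(i < n) p`_(n - i.+1).
have sP : (size (- \poly_(i < n) p`_(n - i.+1))%R < size ('X^n : {poly D})%R)%N.
  by rewrite size_polyN size_polyXn ltnS size_poly.
apply: (@strip_nonunit_coefs _ P) => //.
  by rewrite lead_coefDl // lead_coefXn unitr1.
have -> : ev P f = f ^+ n * f^-1 * (f - ev p f^-1).
  rewrite rmorphB /= map_polyXn hornerD hornerXn hornerN mulrBr divfK //.
  congr (_ - _); rewrite (@horner_coef_wide _ n); last first.
    exact: leq_trans (size_poly _ _) (size_poly _ _).
  rewrite (@horner_coef_wide _ n (map_poly _ p)) ?size_poly // (reindex_inj rev_ord_inj) mulr_sumr.
  apply: eq_bigr => i _ /=; rewrite !coef_map coef_poly /=.
  have lt_in : (n - i.+1 < n)%N by rewrite -subn_gt0 subKn.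
  have -> : (n - (n - i.+1).+1 = i)%N by rewrite -subSn ?subSS ?subKn // ltnW.
  have -> : f ^+ n = f ^+ (n - i.+1) * f ^+ i * f.
    by rewrite -mulrA -exprSr -exprD subnK.
  by rewrite lt_in mulfK // exprVn mulrCA -mulrA divff ?expf_neq0 // mulr1.
apply: pos_valM => // _.
rewrite rvalM ?expf_neq0 ?invr_eq0 // rvalX // rvalV // vf mul0rn oppr0 addr0.
exact: lexx.
Qed.

End FixedRadius.

(** Here f^-1 is f^-1 (1 - f q(f)) + q(f), and V contains Mv. *)
Lemma dominated_inv r V f q : 0 < r -> dominated_by r V -> f != 0 ->
  v r f = 0 -> f \in V -> pos_val (v r) (1 - f * ev q f) -> f^-1 \in V.
Proof.
move=> r0 domV f0 vf fV Mq; have [valV' DV VV] := domV.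
have vr := v_val r0.
have -> : f^-1 = f^-1 * (1 - f * ev q f) + ev q f by field.
have subV := valuation_subring_set valV'.
apply: (subringD subV); last exact: (subring_ev _ subV).
apply: (pos_val_valuation_subring vr valV'); first exact: VV.
by apply: pos_valM => // _; rewrite rvalV // vf oppr0.
Qed.

(** If f had positive value, so would 1 = (1 - f q(f)) + f q(f). *)
Lemma relation_val0 r f q : 0 < r -> f != 0 -> nonneg_val (v r) f ->
  pos_val (v r) (1 - f * ev q f) -> v r f = 0.
Proof.
move=> r0 f0 Of Mq; have vr := v_val r0.
apply/eqP; rewrite eq_le Of // andbT leNgt; apply/negP => vf.
apply: (pos_val1 vr); rewrite -[1](subrK (f * ev q f)).
apply: pos_valD => //; rewrite mulrC; apply: pos_valM => //.
apply: (subring_ev _ (nonneg_val_subring vr)) => // c; exact: v_nonneg.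
Qed.

Section Interval.
Variables (a b : R) (a0 : 0 < a) (ab : a < b).

Let r_gt0 r : a <= r -> 0 < r. Proof. exact: lt_le_trans. Qed.

Definition in_all_dominated f :=
  forall r V, a <= r <= b -> dominated_by r V -> f \in V.

Lemma in_all_dominated_nonneg f r : in_all_dominated f -> a <= r <= b ->
  nonneg_val (v r) f.
Proof.
move=> fT rI; have /andP [/r_gt0 r0 _] := rI.
have domV := nonneg_pred_dominated r0; have [_ _ VV] := domV.
exact/VV/(fT r _ rI domV).
Qed.

(** The alternative holds on small intervals around each t: if v_t(f) = 0, because
    1 - f q(f) keeps a positive value near t; if v_t(f) > 0, by continuity.  It
    passes to unions of adjacent intervals, which share an end point. *)
Lemma val_dichotomy f : in_all_dominated f -> f != 0 ->
  (forall r, a <= r <= b -> v r f = 0) \/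
  (exists2 eps : R, 0 < eps & forall r, a <= r <= b -> eps <= v r f).
Proof.
move=> fT f0.
pose Q (c d : R) := (forall r, c <= r <= d -> v r f = 0) \/
  (exists2 eps : R, 0 < eps & forall r, c <= r <= d -> eps <= v r f).
have near_pos z t : z != 0 -> a <= t -> 0 < v t z ->
    exists2 delta : R, 0 < delta & forall r, a <= r -> `|t - r| < delta ->
      v t z / 2 <= v r z.
  move=> z0 at_ vz; have [L L0 Lz] := v_lipschitz z0.
  exists (v t z / 2 / (L + 1)) => [|r ar]; first by rewrite !divr_gt0 //; lra.
  rewrite ltr_pdivlMr; last by lra.
  have := Lz t r (r_gt0 at_) (r_gt0 ar); have := normr_ge0 (t - r).
  by move: (`|t - r|) => h h0 vt; rewrite mulrDr mulr1 mulrC; lra.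
have near_norm (c d t r delta : R) : c <= t <= d -> d - c < delta ->
    c <= r <= d -> `|t - r| < delta.
  by move=> /andP [? ?] ? /andP [? ?]; rewrite ltr_norml; apply/andP; split; lra.
apply: (@interval_additive _ Q) => [|c d e|t /andP [at_ tb]]; first exact: ltW.
  move=> /andP [ac cd] /andP [de eb] [cd0|[eps e0 cdP]] [de0|[eps' e'0 deP]].
  - left=> r /andP [cr re]; have [rd|dr] := leP r d; first by rewrite cd0 ?cr.
    by rewrite de0 // re ltW.
  - have := deP d; rewrite lexx de => /(_ isT); rewrite cd0 ?lexx ?cd //; lra.
  - have := cdP d; rewrite lexx cd => /(_ isT); rewrite de0 ?lexx ?de //; lra.
  - right; exists (Num.min eps eps') => [|r /andP [cr re]].
      by rewrite lt_min e0.
    rewrite ge_min; have [rd|dr] := leP r d; first by rewrite cdP ?cr.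
    by rewrite deP ?orbT // re ltW.
have tI : a <= t <= b by rewrite at_.
have t0 := r_gt0 at_.
have := in_all_dominated_nonneg fT tI f0; rewrite le0r => /orP [/eqP vf|vf]; last first.
  have [delta d0 near] := near_pos f t f0 at_ vf.
  exists delta => // c d /andP [ac ct] /andP [td db] dc; right.
  exists (v t f / 2) => [|r rcd]; first by lra.
  have /andP [cr rd] := rcd; apply: near; first by lra.
  by apply: near_norm dc rcd; rewrite ct.
have [V domV|q Mq] := unit_relation t0 f0 vf; first exact: (fT t).
have [w0|w0] := eqVneq (1 - f * ev q f) 0.
  exists 1 => // c d /andP [ac ct] /andP [td db] _; left=> r /andP [cr rd].
  have ar : a <= r by lra.
  apply: (@relation_val0 _ _ q) => //; first exact: r_gt0.
    by apply: in_all_dominated_nonneg => //; rewrite ar (le_trans rd).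
  by rewrite w0; apply: pos_val0.
have [delta d0 near] := near_pos _ t w0 at_ (Mq w0).
exists delta => // c d /andP [ac ct] /andP [td db] dc; left=> r rcd.
have /andP [cr rd] := rcd; have ar : a <= r by lra.
apply: (@relation_val0 _ _ q) => //; first exact: r_gt0.
  by apply: in_all_dominated_nonneg => //; rewrite ar (le_trans rd).
move=> _; have : v t (1 - f * ev q f) / 2 <= v r (1 - f * ev q f).
  by apply: near => //; apply: near_norm dc rcd; rewrite ct.
by have := Mq w0; lra.
Qed.

Lemma in_all_dominated_inv f : in_all_dominated f -> f != 0 ->
  (forall r, a <= r <= b -> v r f = 0) -> in_all_dominated f^-1.
Proof.
move=> fT f0 vf r V rI domV; have /andP [/r_gt0 r0 _] := rI.
have [V' domV'|q Mq] := unit_relation r0 f0 (vf r rI); first exact: (fT r).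
by apply: (dominated_inv r0 domV f0 (vf r rI) _ Mq); apply: (fT r).
Qed.

Lemma pos_in_all_dominated f :
  (forall r, a <= r <= b -> pos_val (v r) f) -> in_all_dominated f.
Proof.
move=> fM r V rI domV; have /andP [/r_gt0 r0 _] := rI; have [valV' _ VV] := domV.
apply: (pos_val_valuation_subring (v_val r0) valV').
  exact: VV.
exact: fM.
Qed.

(** The values of g are bounded on the interval, so n eps exceeds them for n
    large. *)
Lemma power_div_in_all_dominated f g (eps : R) : f != 0 -> g != 0 -> 0 < eps ->
    (forall r, a <= r <= b -> eps <= v r f) ->
  exists n, in_all_dominated (f ^+ n / g).
Proof.
move=> f0 g0 e0 vf; have [L L0 Lg] := v_lipschitz g0.
pose C := `|v a g| + L * (b - a).
have [n nC] : exists n : nat, C < n%:R * eps.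
  exists (Num.bound (C / eps)); rewrite -ltr_pdivrMr //; apply: archi_boundP.
  by rewrite divr_ge0 ?(ltW e0) // addr_ge0 // mulr_ge0 // subr_ge0 ltW.
exists n; apply: pos_in_all_dominated => r rI _.
have /andP [ar rb] := rI; have r0 := r_gt0 ar.
have vr := v_val r0.
have vg : v r g <= C.
  apply: le_trans (Lg r a r0 a0) _; apply: lerD; first exact: ler_norm.
  by rewrite ger0_norm ?subr_ge0 // ler_wpM2l //; lra.
have fn0 : f ^+ n != 0 by rewrite expf_neq0.
have g'0 : g^-1 != 0 by rewrite invr_eq0.
rewrite (rvalM vr fn0 g'0) (rvalX vr _ f0) (rvalV vr g0) -mulr_natl.
have : n%:R * eps <= n%:R * v r f by rewrite ler_wpM2l // vf.
by lra.
Qed.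

End Interval.
End ValuationFamily.

(** * The interval ring *)

Section IntervalRing.
Variables (R : realType) (D : idomainType) (x y : D) (a b : R).
Hypothesis reg : regular_local_ring [tuple x; y].
Hypotheses (a0 : 0 < a) (ab : a < b).

Local Notation T := (interval_ring x y `[a, b]).
Local Notation iota := (@FracField.tofrac D).
Local Notation v := (frac_val x y).
Local Notation in_all := (in_all_dominated iota v a b).
Implicit Types (z : {fraction D}) (f g : T).

Let v_val (r : R) : 0 < r -> real_valuation (v r).
Proof. by move=> r0; split=> z t; [exact: frac_valM | exact: frac_valD]. Qed.

Let v_nonneg (r : R) c : 0 < r -> nonneg_val (v r) (iota c).
Proof.
move=> r0; rewrite /nonneg_val /mkset tofrac_eq0 => c0.
by rewrite frac_val_tofrac // dom_val_ge0.
Qed.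

Let v_pos (r : R) c : 0 < r -> c \isn't a GRing.unit -> pos_val (v r) (iota c).
Proof.
move=> r0 cNu; rewrite /pos_val /mkset tofrac_eq0 => c0.
by rewrite frac_val_tofrac // dom_val_nonunit.
Qed.

Let v_lipschitz z : z != 0 -> exists2 L : R, 0 <= L & forall r r',
  0 < r -> 0 < r' -> v r z <= v r' z + L * `|r - r'|.
Proof. exact: frac_val_lipschitz. Qed.

Lemma interval_predP z : z \in interval_pred x y `[a, b] <-> in_all z.
Proof.
split=> [/asboolP zT r V rI [valV DV VV]|zT].
  apply: zT => //; exists r => [|t tV]; first by rewrite /= in_itv.
  have /andP [ar _] := rI.
  by apply/(monomial_valuation_ringP reg t (lt_le_trans a0 ar))/VV.
apply/asboolP => V valV DV [r /=]; rewrite in_itv /= => rI VV.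
apply: (zT r) => //; split=> // t /VV; have /andP [ar _] := rI.
by move/(monomial_valuation_ringP reg t (lt_le_trans a0 ar)).
Qed.

Lemma interval_ring_val_in f : in_all (val f).
Proof. exact/interval_predP/valP. Qed.

Lemma interval_ring_lift z : in_all z -> exists f : T, val f = z.
Proof. by move=> /interval_predP zT; exists (IntervalRing zT). Qed.

Lemma interval_ring_integral f g : f * g = 0 -> f = 0 \/ g = 0.
Proof.
move=> /(congr1 val); rewrite rmorphM rmorph0 => /eqP; rewrite mulf_eq0.
by case/orP => /eqP E; [left|right]; apply: val_inj; rewrite E rmorph0.
Qed.

Lemma interval_ring_dvd_power f g : f != 0 -> g != 0 ->
  (exists h, h * f = 1) \/ (exists n h, f ^+ n = h * g).
Proof.
move=> f0 g0; have val0 (h : T) : h != 0 -> val h != 0.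
  by apply: contra_neq => h0; apply: val_inj; rewrite h0 rmorph0.
have [f0' g0'] := (val0 _ f0, val0 _ g0); have fT := interval_ring_val_in f.
have [vf|[eps e0 vf]] :=
    val_dichotomy v_val v_nonneg v_pos v_lipschitz a0 ab fT f0'.
  have [h hE] := interval_ring_lift
    (in_all_dominated_inv v_val v_nonneg v_pos a0 fT f0' vf).
  by left; exists h; apply: val_inj; rewrite rmorphM rmorph1 /= hE mulVf.
have [n /interval_ring_lift [h hE]] :=
  power_div_in_all_dominated iota v_val v_lipschitz a0 ab f0' g0' e0 vf.
right; exists n, h; apply: val_inj.
by rewrite rmorphXn rmorphM /= hE divfK.
Qed.

Lemma zero_prime_ideal : prime_ideal (pred1 (0 : T)).
Proof.
split; first split.
- by rewrite inE.
- by rewrite inE oner_neq0.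
- by move=> c u w; rewrite !inE => /eqP -> /eqP ->; rewrite mulr0 addr0.
move=> u w; rewrite !inE => /eqP /interval_ring_integral [] ->; rewrite eqxx //.
by rewrite orbT.
Qed.

(** The center of v_a on T. *)
Definition center_a : {pred T} := [pred f | `[< pos_val (v a) (val f) >]].

Lemma center_a_prime_ideal : prime_ideal center_a.
Proof.
have va := v_val a0.
have nonnegT f : nonneg_val (v a) (val f).
  apply: (in_all_dominated_nonneg v_val v_nonneg a0 (interval_ring_val_in f)).
  by rewrite lexx ltW.
split; first split.
- by apply/asboolP; rewrite rmorph0; apply: pos_val0.
- by apply/asboolP; rewrite rmorph1; apply: pos_val1.
- move=> c u w /asboolP vu /asboolP vw; apply/asboolP.
  rewrite rmorphD rmorphM; exact: (pos_valD va (pos_valM va (nonnegT c) vu) vw).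
move=> u w /asboolP; rewrite rmorphM => vuw.
apply/orP; have [vu|vu] := EM (pos_val (v a) (val u)); first by left; apply/asboolP.
right; apply/asboolP => w0.
have u0 : val u != 0 by apply/eqP => u0; apply: vu; rewrite u0; apply: pos_val0.
have vu0 : v a (val u) <= 0 by rewrite leNgt; apply/negP => lt0; apply: vu.
have := vuw (mulf_neq0 u0 w0); rewrite (rvalM va) //; lra.
Qed.

Lemma interval_ring_krull_dim : krull_dim_is T 1.
Proof.
split.
  exists (fun i => if i is 0%N then (pred1 0 : {pred T}) else center_a); split.
    by case=> [|i] _; [exact: zero_prime_ideal | exact: center_a_prime_ideal].
  case=> // _; split.
    by move=> f /eqP ->; have [[]] := center_a_prime_ideal.
  have x0 := x_neq0 reg; have xNu := x_nonunit reg.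
  have [|X XE] := @interval_ring_lift (iota x).
    by move=> r V _ [_ DV _]; apply: DV.
  exists X; first by apply/asboolP; rewrite XE; apply: v_pos.
  apply/eqP => X0; move: XE; rewrite X0 rmorph0 => /esym/eqP.
  by rewrite tofrac_eq0 (negPf x0).
move=> m C [Cprime Clt]; rewrite leqNgt; apply/negP => m2.
have [_ [g gC1 gC0]] := Clt 0%N (ltnW m2).
have [_ [f fC2 fC1]] := Clt 1%N m2.
have [[C0_0 _ _] _] := Cprime 0%N isT.
have [[C1_0 C1_1 C1D] C1prime] := Cprime 1%N (ltnW m2).
have [[C2_0 C2_1 C2D] _] := Cprime 2%N m2.
have g0 : g != 0 by apply: contraNneq gC0 => ->.
have f0 : f != 0 by apply: contraNneq fC1 => ->.
have [[h hf]|[n [h fn]]] := interval_ring_dvd_power f0 g0.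
  by case/negP: C2_1; rewrite -hf -[h * f]addr0; apply: C2D.
have : f ^+ n \in C 1%N by rewrite fn -[h * g]addr0; apply: C1D.
elim: n {fn} => [|n IH]; first by rewrite expr0 (negPf C1_1).
by rewrite exprS => /C1prime; rewrite (negPf fC1).
Qed.

End IntervalRing.

Theorem mainTheorem2 (R : realType) (D : idomainType) (x y : D) (a b : R) :
  regular_local_ring [tuple x; y] ->
  0 < a -> a < b ->
  krull_dim_is (interval_ring x y `[a, b]) 1.
Proof. exact: interval_ring_krull_dim. Qed.
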